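(* Let $q$ be a prime power and let $\mathcal{C}$ be an $[n,k,d]$ linear block code over $\mathbb{F}_q$ with generator matrix $H\in\mathbb{F}_q^{n\times k}$ (so the codewords are $Hx$, $x\in\mathbb{F}_q^k$) whose $n$ rows are pairwise distinct. Let $p<n$ be a positive integer, $y=p/n$, and let $A$ be the number of codewords of weight $4$ in the dual code $\mathcal{C}^\perp$. Let $\Omega_p$ be the set of all maps $s:\{1,\dots,p\}\to\mathcal{D}$, where $\mathcal{D}=\epsilon(\mathcal{C})$, with the uniform probability; for $s\in\Omega_p$ let $\mathcal{G}(s)$ be the $p\times p$ matrix with $(i,j)$-entry $\langle s(i),s(j)\rangle/n$, where $\langle u,v\rangle=\sum_t u_t\overline{v_t}$, and let $A_l(s)=\frac1p\mathrm{tr}(\mathcal{G}(s)^l)$. Then for every integer $l$ with $2\le l<\sqrt p$, \[\mathbb{E}(A_l(s),\Omega_p)=\sum_{i=0}^{l-1}\frac{y^i}{i+1}\binom{l}{i}\binom{l-1}{i}+E_l,\qquad |E_l|\le\left(4+2\sqrt{\frac{2A}{q-1}+\frac14}\right)\frac{l^{l+1}}{n}.\]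
   Context: For $q$ with characteristic $\ell$, $\psi:\mathbb{F}_q\to\mathbb{C}^*$ is $\psi(z)=\exp\big(2\pi\sqrt{-1}\,\mathrm{tr}_{\mathbb{F}_q/\mathbb{F}_\ell}(z)/\ell\big)$ and $\epsilon:\mathbb{F}_q^n\to(\mathbb{C}^* )^n$ applies $\psi$ componentwise. $\mathcal{C}^\perp$ is the dual code with respect to the standard bilinear inner product on $\mathbb{F}_q^n$. $\mathbb{E}(\cdot,\Omega_p)$ denotes expectation over $s$ uniform in $\Omega_p$. *)

(* Defs.v *)
From mathcomp Require Import all_boot all_order all_algebra.
From mathcomp Require Import all_fingroup all_field.
From mathcomp Require Import finmap complex reals trigo.

Set Implicit Arguments.
Unset Strict Implicit.
Unset Printing Implicit Defensive.

Import Order.TTheory GRing.Theory Num.Theory.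
Local Open Scope ring_scope.
Local Open Scope complex_scope.

Section FieldTrace.
Variables (F : finFieldType) (ell : nat) (charF : ell \in [pchar F]).

(* The library's Galois trace of F over its prime field takes its values in the
   line 1%AS of F; ftrace reads such a value back as an element of 'F_ell. *)
Definition ftrace (z : F) : 'F_ell :=
  odflt 0 [pick a : 'F_ell |
    (a%:A : pPrimeCharType charF) ==
      galTrace 1%AS {: pPrimeCharType charF}%AS z].

Lemma ftraceP (z : F) :
  ((ftrace z)%:A : pPrimeCharType charF) =
    galTrace 1%AS {: pPrimeCharType charF}%AS z.
Proof.
rewrite /ftrace; case: pickP => [a /eqP // | no_a].
have /mem_galTrace/(_ (memvf (z : pPrimeCharType charF))) :
  galois 1%AS {: pPrimeCharType charF}%AS by apply: finField_galois; rewrite sub1v.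
by case/vlineP => a def_a; have := no_a a; rewrite def_a eqxx.
Qed.

End FieldTrace.

Section Codes.
Variables (F : finFieldType) (n : nat).
Implicit Types (C : {vspace 'cV[F]_n}) (u v c : 'cV[F]_n).

Definition hweight v : nat := #|[set i | v i 0 != 0]|.

Definition hdist u v : nat := hweight (u - v).

Definition has_min_distance C (d : nat) : Prop :=
  (exists u v, [/\ u \in C, v \in C, u != v & hdist u v = d]) /\
  (forall u v, u \in C -> v \in C -> u != v -> (d <= hdist u v)%N).

Definition linear_code C (k d : nat) : Prop :=
  \dim C = k /\ has_min_distance C d.

Definition generator_matrix (k : nat) (H : 'M[F]_(n, k)) C : Prop :=
  \dim C = k /\ (forall c, c \in C <-> exists x : 'cV[F]_k, c = H *m x).

Definition dual_code C : {set 'cV[F]_n} :=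
  [set v : 'cV[F]_n | [forall c : 'cV[F]_n, (c \in C) ==> (\sum_t v t 0 * c t 0 == 0)]].

End Codes.

Section RandomMatrix.
Variable R : realType.

(* exp (sqrt(-1) * x) for real x *)
Definition expi (x : R) : R[i] := cos x +i* sin x.

Definition psi (F : finFieldType) (ell : nat) (charF : ell \in [pchar F])
    (z : F) : R[i] :=
  expi (2 * pi * (ftrace charF z : nat)%:R / ell%:R).

Definition epsilon (F : finFieldType) (ell : nat) (charF : ell \in [pchar F])
    (n : nat) (v : 'cV[F]_n) : 'cV[R[i]]_n :=
  \col_t psi charF (v t 0).

Definition epsilon_code (F : finFieldType) (ell : nat)
    (charF : ell \in [pchar F]) (n : nat) (C : {vspace 'cV[F]_n}) :
    {fset 'cV[R[i]]_n} :=
  [fset epsilon charF c | c in [set c : 'cV[F]_n | c \in C]]%fset.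

Definition hermitian (n : nat) (u v : 'cV[R[i]]_n) : R[i] :=
  \sum_t u t 0 * (v t 0)^*.

Definition Omega (n p : nat) (D : {fset 'cV[R[i]]_n}) : finType :=
  {ffun 'I_p -> D}.

Definition gram (n p : nat) (D : {fset 'cV[R[i]]_n}) (s : Omega p D) :
    'M[R[i]]_p :=
  \matrix_(i, j) (hermitian (val (s i)) (val (s j)) / n%:R).

Definition moment (n p : nat) (D : {fset 'cV[R[i]]_n}) (l : nat)
    (s : Omega p D) : R[i] :=
  \tr (gram s ^+ l) / p%:R.

Definition expectation (T : finType) (X : T -> R[i]) : R[i] :=
  (\sum_s X s) / #|T|%:R.

End RandomMatrix.

(* Main.v *)
Require Import Defs.
From mathcomp Require Import all_boot all_order all_algebra.
From mathcomp Require Import all_fingroup all_field.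
From mathcomp Require Import finmap complex reals trigo.
From mathcomp Require Import zify ring lra.

(* Expanding the trace and averaging the characters over the code, the expected
   moment is 1/(p n^l) times the number of pairs (w, t), where w is a word of
   length l in p letters and t labels the edges of the closed walk traced by w
   with elements of [n] so that the rows h_t of H form a circulation: inflow
   equals outflow at every letter.

   The entry edges of the letters form a spanning tree, so a word with v letters
   carries at most n^(l+1-v) circulations, with equality for noncrossing words,
   which reduce to a point by erasing loops and letters occurring once.  A
   crossing word x..y..x..y has a tree edge whose fundamental cut contains at
   least four edges, so that the tree edge e and another edge f of the cut satisfy
   h_e - h_f = delta with delta determined by the remaining edges.  If delta <> 0
   there are only O(sqrt(A/(q-1))) solutions, since two disjoint solutions make up
   a dual codeword of weight 4; delta = 0 is an additional constraint on the
   remaining cut edges.  Either way a factor n is traded for this quantity.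

   Noncrossing words are recognised by a stack, and counted by the numbers of
   pairs of nonintersecting lattice paths, which are the Narayana numbers. *)

Set Implicit Arguments.
Unset Strict Implicit.
Unset Printing Implicit Defensive.

Import Order.TTheory GRing.Theory Num.Theory.

(** * Noncrossing words *)

Section Stack.
Variable T : eqType.
Implicit Types (w s : seq T) (x y z : T).

(* Words are read from the end of the list, the top of the stack is its head;
   reading a stacked letter pops the letters above it, and rereading a popped
   letter is a crossing. *)
Fixpoint ncstack w : option (seq T) :=
  if w is x :: w' then
    if ncstack w' is Some s then
      if x \in s then Some (drop (index x s) s)
      else if x \in w' then None else Some (x :: s)
    else None
  else Some [::].

Definition nvert w := size (undup w).

(** [undup] keeps the occurrence of a letter nearest the end of the list, which is its first
    reading. So the stack is ordered by first reading, the latest on top. *)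
Lemma ncstack_subseq w s : ncstack w = Some s -> subseq s (undup w).
Proof.
elim: w s => [|x w IHw] s /=; first by move=> [<-].
case: (ncstack w) IHw => [s0|] // IHw.
have sub0 := IHw _ erefl.
case: ifP => [x_s0 [<-]|_].
  have x_w : x \in w by rewrite -mem_undup; apply: (mem_subseq sub0).
  by rewrite x_w; apply: subseq_trans (drop_subseq _ _) sub0.
by case: ifP => // _ [<-] /=; rewrite eqxx.
Qed.

Lemma ncstack_uniq w s : ncstack w = Some s -> uniq s.
Proof. by move/ncstack_subseq/subseq_uniq; apply; apply: undup_uniq. Qed.

Lemma ncstack_mem w s x : ncstack w = Some s -> x \in s -> x \in w.
Proof. by move/ncstack_subseq/mem_subseq => sub /sub; rewrite mem_undup. Qed.

Lemma drop_index_cons x s : x \in s ->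
  drop (index x s) s = x :: drop (index x s).+1 s.
Proof. by move=> x_s; rewrite (drop_nth x) ?index_mem // nth_index. Qed.

Lemma mem_drop_index i x s : x \in s -> (i <= index x s)%N -> x \in drop i s.
Proof.
move=> xs le_i; rewrite -[X in X \in _](nth_index x xs) -(subnKC le_i) -nth_drop.
have lt_x : (index x s < size s)%N by rewrite index_mem.
by rewrite mem_nth // size_drop ltn_sub2r // (leq_ltn_trans le_i).
Qed.

Lemma split_last x w : x \in w ->
  exists b c, w = b ++ x :: c /\ x \notin c.
Proof.
elim: w => // z w IHw; rewrite inE; have [/IHw [b [c [-> xc]]] _|xw] := boolP (x \in w).
  by exists (z :: b), c.
by rewrite orbF => /eqP <-; exists [::], w.
Qed.

Lemma subseq_cons_catl x s b c : x \notin b ->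
  subseq (x :: s) (b ++ x :: c) -> subseq s c.
Proof.
elim: b => [|z b IHb] /=; first by rewrite eqxx.
by rewrite inE negb_or => /andP[/negbTE -> /IHb].
Qed.

(** A letter leaves the stack only when a letter [y] below it is reread. Lying below [x], this [y]
    was first read before [x], hence occurs in [c]; the displayed [y] is the rereading. *)
Lemma dead_letter w s x : ncstack w = Some s -> x \in w -> x \notin s ->
  exists a y b c, [/\ w = a ++ y :: b ++ x :: c, y \in c & x \notin c].
Proof.
elim: w s => // z w IHw s /=.
case Es0: (ncstack w) => [s0|] //.
case: ifP => [z_s0 [<-]|z_s0].
  rewrite drop_index_cons // !inE negb_or => /orP[/eqP ->|x_w]; first by rewrite eqxx.
  case/andP => x_z x_drop.
  have [x_s0|x_s0] := boolP (x \in s0); last first.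
    have [a [y [b [c [-> yc xc]]]]] := IHw _ Es0 x_w x_s0.
    by exists (z :: a), y, b, c.
  have sub := ncstack_subseq Es0.
  have lt_xz : (index x s0 < index z s0)%N.
    rewrite ltn_neqAle; apply/andP; split.
      apply/eqP => /(congr1 (nth x s0)); rewrite !nth_index // => exz.
      by rewrite exz eqxx in x_z.
    rewrite leqNgt; apply/negP => lt_zx; case/negP: x_drop.
    exact: mem_drop_index.
  have [b [c [def_w xc]]] := split_last x_w.
  (* The part of the stack below [x] consists of letters read before [x]; this places [z] in [c]. *)
  have subx : subseq (x :: drop (index x s0).+1 s0) (undup w).
    rewrite -drop_index_cons //; exact: subseq_trans (drop_subseq _ _) sub.
  rewrite def_w undup_cat /= (negbTE xc) in subx.
  have {subx} subx : subseq (drop (index x s0).+1 s0) (undup c).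
    by apply: subseq_cons_catl subx; rewrite mem_filter inE eqxx.
  exists [::], z, b, c; split=> //; first by rewrite def_w.
  rewrite -mem_undup; apply: (mem_subseq subx).
  exact: mem_drop_index.
case: ifP => // z_w [<-]; rewrite !inE negb_or => /orP[/eqP ->|x_w]; first by rewrite eqxx.
case/andP => _ x_s0.
have [a [y [b [c [-> yc xc]]]]] := IHw _ Es0 x_w x_s0.
by exists (z :: a), y, b, c.
Qed.

Lemma ncstack_None w : ncstack w = None ->
  exists a x a' y b c,
    [/\ w = a ++ x :: a' ++ y :: b ++ x :: c, y \in c & x \notin c].
Proof.
elim: w => // z w IHw /=.
case Es0: (ncstack w) => [s0|]; last first.
  move=> _; have [a [x [a' [y [b [c [-> yc xc]]]]]]] := IHw Es0.
  by exists (z :: a), x, a', y, b, c.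
case: ifP => // zs0; case: ifP => // zw _.
have [a [y [b [c [-> yc xc]]]]] := dead_letter Es0 zw (negbT zs0).
by exists [::], z, a, y, b, c.
Qed.

(** The run over [b] depends on what precedes it only through the stack and through which letters of
    [b] have been read. *)
Lemma ncstack_cat b w1 w2 : ncstack w1 = ncstack w2 ->
  {in b, forall z, (z \in w1) = (z \in w2)} ->
  ncstack (b ++ w1) = ncstack (b ++ w2).
Proof.
move=> E12; elim: b => //= z b IHb eq12.
rewrite IHb => [|y yb]; last by apply: eq12; rewrite inE yb orbT.
by rewrite !mem_cat eq12 ?mem_head.
Qed.

Lemma dead_not_read b w s s' x : ncstack w = Some s -> x \in w -> x \notin s ->
  ncstack (b ++ w) = Some s' -> x \notin b /\ x \notin s'.
Proof.
move=> Es xw xs; elim: b s' => [|z b IHb] s' /=; first by rewrite Es => -[<-].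
case Es0: (ncstack _) => [s0|] //; have [xb xs0] := IHb _ Es0.
case: ifP => [zs0 [<-]|_].
  rewrite inE negb_or xb andbT; split.
    by apply: contraNneq xs0 => ->.
  by apply: contraNN xs0; apply: mem_drop.
case: ifP => // zbw [<-]; rewrite !inE !negb_or xb xs0 !andbT.
suff -> : x != z by [].
by apply/eqP => exz; rewrite -exz mem_cat xw orbT in zbw.
Qed.

Lemma ncstack_of_uniq w : uniq w -> ncstack w = Some w.
Proof.
elim: w => //= x w IHw /andP[xw /IHw ->].
by rewrite (negbTE xw).
Qed.

Lemma first_repeat w : ~~ uniq w ->
  exists b y x a, [/\ w = b ++ y :: x :: a, uniq (x :: a) & y \in x :: a].
Proof.
elim: w => //= z w IHw; rewrite negb_and negbK.
have [uw|/IHw [b [y [x [a [-> ua ya]]]]] _] := boolP (uniq w); last first.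
  by exists (z :: b), y, x, a.
rewrite orbF; case: w uw {IHw} => // x a ua za.
by exists [::], z, x, a.
Qed.

(** Here [y] is the first repetition met in reading. If [y] differs from [x], rereading [y] pops
    [x]; being dead, [x] never recurs, so it occurs once in the whole word and its deletion leaves
    the run unchanged. *)
Lemma ncstack_reduce b y x a s : uniq (x :: a) -> y \in x :: a ->
    ncstack (b ++ y :: x :: a) = Some s ->
  if y == x then ncstack (b ++ x :: a) = Some s
  else [/\ y \in a, x \notin b & ncstack (b ++ y :: a) = Some s].
Proof.
move=> ua ya; have Exa := ncstack_of_uniq ua.
have Ea : ncstack a = Some a by apply: ncstack_of_uniq; case/andP: ua.
case: eqP => [yx|/eqP yx] Es.
  rewrite -Es yx; apply: ncstack_cat.
    by rewrite -/(ncstack _) [in RHS]/= -/(ncstack (x :: a)) Exa mem_head /= eqxx.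
  by move=> z _; rewrite !inE orbA orbb.
have {}ya : y \in a by move: ya; rewrite inE (negbTE yx).
have Ey : ncstack (y :: x :: a) = Some (drop (index y a) a).
  by rewrite [LHS]/= -/(ncstack (x :: a)) Exa inE ya orbT /= eq_sym (negbTE yx).
have xdead : x \notin drop (index y a) a.
  by apply: contraTN ua => /mem_drop /= ->.
have xin : x \in y :: x :: a by rewrite !inE eqxx orbT.
have [xb _] := dead_not_read Ey xin xdead Es.
split=> //; rewrite -Es; apply: ncstack_cat.
  by rewrite Ey /= Ea ya.
move=> z zb; rewrite !inE; case: (z =P x) => [zx|]; last by rewrite orFb.
by rewrite -zx zb in xb.
Qed.

End Stack.

(** * Counting noncrossing words *)

Lemma big_tuple_cons (R : Type) (idx : R) (op : Monoid.com_law idx)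
    (T : finType) (m : nat) (G : seq T -> R) :
  \big[op/idx]_(w : m.+1.-tuple T) G w
    = \big[op/idx]_(w : m.-tuple T) \big[op/idx]_(x : T) G (x :: w).
Proof.
rewrite pair_big /=.
rewrite (reindex (fun u : m.-tuple T * T => [tuple of u.2 :: u.1])) /=; first by [].
exists (fun w : m.+1.-tuple T => ([tuple of behead w], thead w)) => [[w x] _|w _] /=.
  by congr (_, _); apply: val_inj.
by rewrite [RHS]tuple_eta; apply: val_inj.
Qed.

Section Counting.
Variable T : finType.
Local Notation p := #|T|.
Local Open Scope nat_scope.

(* Weighting by binomials of the stack height amounts to choosing which of the
   stacked blocks are still open; this makes the counting recurrence finite. *)
Definition open_choices o (w : seq T) : nat :=
  if ncstack w is Some s then 'C(size s, o) else 0.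

Definition nc_count m v o : nat :=
  \sum_(w : m.-tuple T | nvert w == v) open_choices o w.

(** Rereading a stacked letter cuts the stack down to that letter, so each height from 1 to [size s]
    arises exactly once. *)
Lemma sum_drop_index (G : nat -> nat) (s : seq T) : uniq s ->
  \sum_(x in s) G (size (drop (index x s) s)) = \sum_(i < size s) G i.+1.
Proof.
move=> us; rewrite -big_uniq //=.
case Es: s => [|x0 s']; first by rewrite big_nil big_ord0.
rewrite -Es (big_nth x0) big_mkord (reindex_inj rev_ord_inj).
apply: eq_bigr => i _; have lt_i := ltn_ord i.
rewrite size_drop index_uniq //=; last by lia.
by congr G; lia.
Qed.

(** The hockey-stick identity started at 1. For [o = 0] the absent term 'C(0, 0) = 1 cancels 'C(h,
    0), whence the factor [(0 < o)]. *)
Lemma sum_binS h o : \sum_(i < h) 'C(i.+1, o) = 'C(h, o.+1) + (0 < o) * 'C(h, o).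
Proof.
elim: h => [|h IHh]; first by rewrite big_ord0; case: o.
by rewrite big_ord_recr /= IHh; case: o {IHh} => [|o]; rewrite ?binS ?bin0 /=; lia.
Qed.

Lemma nvert_cons x (w : seq T) : nvert (x :: w) = (x \notin w) + nvert w.
Proof. by rewrite /nvert /=; case: ifP. Qed.

(** The next letter is stacked (summed by [sum_binS]), dead (contributing 0), or one of the [p - v]
    fresh letters, which raises the stack by one and splits the binomial by Pascal's rule. *)
Lemma open_choices_cons (w : seq T) v o :
  \sum_(x : T | nvert (x :: w) == v.+1) open_choices o (x :: w) =
  (nvert w == v) * ((p - v) * (open_choices o w + (0 < o) * open_choices o.-1 w))
  + (nvert w == v.+1) * (open_choices o.+1 w + (0 < o) * open_choices o w).
Proof.
rewrite /open_choices /=; case Es: (ncstack w) => [s|]; last first.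
  by rewrite big1 //; lia.
have us := ncstack_uniq Es.
have sw x : x \in s -> x \in w := ncstack_mem Es.
rewrite big_mkcond (bigID (mem s)) /=.
rewrite [X in X + _](eq_bigr (fun x => (nvert w == v.+1) * 'C(size (drop (index x s) s), o))); last first.
  by move=> x xs; rewrite nvert_cons (sw _ xs) xs /= add0n; case: eqP; lia.
rewrite -big_distrr /= (sum_drop_index (fun k => 'C(k, o))) // sum_binS addnC; congr (_ + _).
rewrite (bigID (mem w)) /= [X in X + _]big1 ?add0n => [|x /andP[/negbTE -> ->]]; last by rewrite if_same.
rewrite (eq_bigr (fun x => (nvert w == v) * 'C((size s).+1, o))); last first.
  move=> x /andP[xs xw]; rewrite nvert_cons xw (negbTE xs) (negbTE xw) /= eqSS.
  by case: eqP; lia.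
rewrite sum_nat_const; case: eqP => [wv|_]; last by lia.
rewrite (_ : #|_| = p - v); last first.
  rewrite -wv /nvert -(card_uniqP (undup_uniq w)) -[X in _ = X - _](cardC (mem w)).
  rewrite (eq_card (mem_undup w)) addKn; apply: eq_card => x.
  rewrite [LHS]/in_mem /= !inE; case: (boolP (x \in w)) => [_|xw]; rewrite ?andbF // andbT.
  by apply: contraNN xw => /sw.
by case: o => [|o]; rewrite ?bin0 ?binS /=; lia.
Qed.

Lemma nc_count_rec m v o :
  nc_count m.+1 v.+1 o =
    (p - v) * (nc_count m v o + (0 < o) * nc_count m v o.-1)
    + (nc_count m v.+1 o.+1 + (0 < o) * nc_count m v.+1 o).
Proof.
rewrite /nc_count big_mkcond /=.
rewrite (@big_tuple_cons _ _ _ T m (fun w : seq T => if nvert w == v.+1 then open_choices o w else 0)).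
transitivity (\sum_(w : m.-tuple T)
    \sum_(x : T | nvert (x :: w) == v.+1) open_choices o (x :: w)).
  by apply: eq_bigr => w _; rewrite [RHS]big_mkcond.
rewrite (eq_bigr _ (fun (w : m.-tuple T) _ => open_choices_cons w v o)).
rewrite big_split /=; congr (_ + _).
  rewrite [X in _ = _ * (_ + X)]big_distrr -big_split big_distrr [RHS]big_mkcond /=.
  by apply: eq_bigr => w _; case: eqP; lia.
rewrite [X in _ = _ + X]big_distrr -big_split [RHS]big_mkcond /=.
by apply: eq_bigr => w _; case: eqP; lia.
Qed.

Lemma nc_count_0 m o : nc_count m.+1 0 o = 0.
Proof.
rewrite /nc_count big_pred0 // => w; case/tupleP: w => x w.
by rewrite nvert_cons /=; case: (boolP (x \in w)) => //; rewrite /nvert -mem_undup; case: undup.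
Qed.

(** * Ballot numbers: the closed form of the counting recurrence *)

Local Open Scope ring_scope.

(** The guard matters: for [o > a] truncated subtraction would give 'C(m, 0) = 1 instead of 0. *)
Definition bin_shift m a o : int := if (o <= a)%N then 'C(m, a - o)%:Z else 0.

Lemma bin_shiftS m a o :
  bin_shift m.+1 a.+1 o = bin_shift m a.+1 o + bin_shift m a o.
Proof.
rewrite /bin_shift; have [oa|] := leqP o a.
  by rewrite leqW // subSn // binS PoszD.
rewrite leq_eqVlt => /orP[/eqP <-|oa]; first by rewrite leqnn subnn !bin0 addr0.
by rewrite leqNgt oa addr0.
Qed.

Lemma bin_shiftSr m a o :
  bin_shift m.+1 a o = bin_shift m a o + bin_shift m a o.+1.
Proof.
case: a => [|a]; first by rewrite /bin_shift addr0; case: o => [|o]; rewrite ?bin0.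
by rewrite bin_shiftS /bin_shift ltnS subSS.
Qed.

Lemma bin_shiftSS m a o : bin_shift m a.+1 o.+1 = bin_shift m a o.
Proof. by rewrite /bin_shift ltnS subSS. Qed.

(* The reflection-principle count of pairs of dominated lattice paths: choose
   the positions where a block opens and those where a block closes. *)
Definition ballot m v o : int :=
  'C(m, v)%:Z * bin_shift m.+1 v.+1 o - 'C(m, v.+1)%:Z * bin_shift m.+1 v o.

Lemma bin_shift_big m a o : (a < o)%N -> bin_shift m a o = 0.
Proof. by rewrite /bin_shift ltnNge => /negbTE ->. Qed.

Lemma bin_shift_0 m a : bin_shift m a 0 = 'C(m, a)%:Z.
Proof. by rewrite /bin_shift subn0. Qed.

Lemma ballot_rec m v o :
  ballot m.+1 v.+1 o =
    ballot m v o + (0 < o)%N%:Z * ballot m v o.-1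
    + ballot m v.+1 o.+1 + (0 < o)%N%:Z * ballot m v.+1 o.
Proof.
rewrite /ballot !bin_shiftSS; case: o => [|o] /=.
  rewrite !mul0r !addr0 !bin_shift_0 !binS !PoszD; ring.
rewrite !mul1r !bin_shiftSS.
rewrite !(bin_shiftSr m.+1) !bin_shiftSS !binS !PoszD; ring.
Qed.

Lemma ballot_rec0 m o :
  ballot m.+1 0 o = ballot m 0 o.+1 + (0 < o)%N%:Z * ballot m 0 o.
Proof.
rewrite /ballot !bin_shiftSS; case: o => [|o] /=.
  by rewrite mul0r !bin_shift_0 !bin0 !bin1 !(@bin_shift_big _ 0 1) //; ring.
rewrite !mul1r !bin_shiftSS !(@bin_shift_big _ 0 _.+1) // !bin0.
by rewrite (bin_shiftSr m.+1) (@bin_shift_big _ 0 _.+1) //; ring.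
Qed.

Lemma nc_count_nil v o : nc_count 0 v o = ((v == 0%N) * (o == 0%N))%N.
Proof.
rewrite /nc_count big_mkcond (big_pred1 [tuple]) /= => [|w]; last by apply/esym/eqP; rewrite [w]tuple0.
by rewrite /nvert /open_choices /= eq_sym; case: eqP; case: o.
Qed.

(** Both sides obey the same recurrence. The falling factorial counts the choices of distinct
    letters, and [ballot] the weighted patterns of repetition. *)
Lemma nc_countE m v o :
  (nc_count m.+1 v.+1 o)%:Z = (p ^_ v.+1)%:Z * ballot m v o.
Proof.
elim: m v o => [|m IHm] v o.
  rewrite nc_count_rec !nc_count_nil /ballot /= !muln0 !addn0.
  case: v => [|v]; last by rewrite bin0n /= !mul0r subrr mulr0 !muln0.
  rewrite subn0 ffactn1 bin0 bin0n /= mul0r subr0 mul1r.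
  case: o => [|[|o]].
  - by rewrite bin_shift_0 mulr1 muln1.
  - by rewrite bin_shiftSS bin_shift_0 mulr1 muln1.
  - by rewrite bin_shift_big // mulr0 muln0.
have PoszE a b c d e f : ((a * (b + c * d) + (e + c * f))%N)%:Z =
    a%:Z * (b%:Z + c%:Z * d%:Z) + (e%:Z + c%:Z * f%:Z) by lia.
rewrite nc_count_rec PoszE; case: v => [|v].
  by rewrite !nc_count_0 !IHm ballot_rec0; ring.
have Eff : (p ^_ v.+2)%:Z = (p ^_ v.+1)%:Z * (p - v.+1)%N%:Z.
  by rewrite -PoszM -ffactnSr.
by rewrite !IHm ballot_rec Eff; ring.
Qed.

(** Thus [ballot m v 0] is the Narayana number with parameters [m.+1] and [v.+1], the coefficient of
    the main term. *)
Lemma ballot_diag m v :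
  v.+1%:Z * ballot m v 0 = 'C(m.+1, v)%:Z * 'C(m, v)%:Z.
Proof.
rewrite /ballot !bin_shift_0; have [vm|vm] := leqP v m; last first.
  by rewrite [in 'C(m, v)]bin_small // ['C(m, v.+1)]bin_small 1?ltnW // !mul0r subrr !mulr0.
have E1 : v.+1%:Z * 'C(m.+1, v.+1)%:Z = (m.+1 - v)%N%:Z * 'C(m.+1, v)%:Z.
  by rewrite -!PoszM mul_bin_left.
have E2 : v.+1%:Z * 'C(m, v.+1)%:Z = (m - v)%N%:Z * 'C(m, v)%:Z.
  by rewrite -!PoszM mul_bin_left.
rewrite mulrBr mulrCA E1 [X in _ - X]mulrA E2 subSn // -[(m - v).+1]addn1 PoszD; ring.
Qed.

Lemma ballot_ge0 m v : 0 <= ballot m v 0.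
Proof. by rewrite -(@pmulr_rge0 _ v.+1%:Z) // ballot_diag -PoszM. Qed.

Lemma nvert_gt0 (w : seq T) : (0 < size w)%N -> (0 < nvert w)%N.
Proof.
case: w => // x w _; rewrite /nvert.
by have : x \in undup (x :: w); [rewrite mem_undup mem_head | case: undup].
Qed.

Lemma nvert_le (w : seq T) : (nvert w <= size w)%N.
Proof. exact: size_undup. Qed.

(** At [o = 0] the weight 'C(size s, 0) is 1, so [open_choices] is the indicator of noncrossing
    words. *)
Lemma sum_nc (R : comPzRingType) m (G : nat -> R) :
  \sum_(w : m.+1.-tuple T | ncstack w) G (nvert w)
    = \sum_(v < m.+1) (p ^_ v.+1)%:R * (ballot m v 0)%:~R * G v.+1.
Proof.
rewrite (partition_big (fun w : m.+1.-tuple T => inord (nvert w).-1 : 'I_m.+1) predT) //=.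
apply: eq_bigr => v _.
rewrite -[(p ^_ v.+1)%:R]/((p ^_ v.+1)%:Z%:~R) -intrM -nc_countE /nc_count.
rewrite -[X in X * _]/((_)%:R) natr_sum mulr_suml [LHS]big_mkcond [RHS]big_mkcond /=.
apply: eq_bigr => w _; rewrite /open_choices.
have w0 : (0 < nvert w)%N by rewrite nvert_gt0 ?size_tuple.
have wm : (nvert w <= m.+1)%N by rewrite -[X in (_ <= X)%N](size_tuple w) nvert_le.
rewrite -val_eqE /= inordK; last by lia.
rewrite (_ : ((nvert w).-1 == v) = (nvert w == v.+1)); last by lia.
case: eqP => [->|_]; last by rewrite andbF.
by rewrite andbT; case: ncstack => [s|]; rewrite ?bin0 ?mul1r ?mul0r.
Qed.

(** Prepending a letter multiplies the sum by at most [m.+2 * n]: at most [m.+1] old letters each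
    cost a factor [n], and at most [p <= n] new ones leave the power of [n] unchanged. *)
Lemma sum_nvert_le m n : (p <= n)%N ->
  (\sum_(w : m.+1.-tuple T) n ^ (m.+1 - nvert w) <= m.+1`! * (p * n ^ m))%N.
Proof.
move=> le_pn; elim: m => [|m IHm].
  rewrite (@big_tuple_cons _ _ _ T 0 (fun w => n ^ (1 - nvert w))%N) (big_pred1 [tuple]) => [|w]; last first.
    by apply/esym/eqP; rewrite [w]tuple0.
  by rewrite mul1n muln1 sum_nat_const muln1.
rewrite (@big_tuple_cons _ _ _ T _ (fun w => n ^ (m.+2 - nvert w))%N).
apply: (@leq_trans (\sum_(w : m.+1.-tuple T) m.+2 * n * n ^ (m.+1 - nvert w))); last first.
  rewrite -big_distrr /= factS expnS.
  rewrite [X in (_ <= X)%N](_ : _ = m.+2 * n * (m.+1`! * (p * n ^ m)))%N; last by ring.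
  by rewrite leq_mul2l IHm orbT.
apply: leq_sum => w _.
have wm : (nvert w <= m.+1)%N by rewrite -[X in (_ <= X)%N](size_tuple w) nvert_le.
rewrite (bigID (mem w)) /=.
rewrite (eq_bigr (fun _ => n * n ^ (m.+1 - nvert w))%N) => [|x xw]; last first.
  by rewrite nvert_cons xw add0n subSn // expnS.
rewrite [X in (_ + X <= _)%N](eq_bigr (fun _ => n ^ (m.+1 - nvert w))%N) => [|x xw]; last first.
  by rewrite nvert_cons xw add1n subSS.
rewrite !sum_nat_const.
have -> : #|[pred x in w]| = nvert w.
  by rewrite /nvert -(card_uniqP (undup_uniq w)); apply: eq_card => x; rewrite !inE mem_undup.
have : (#|[pred x | x \notin w]| <= p)%N by apply: max_card.
set c := #|_|; set e := (n ^ _)%N => le_c.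
rewrite mulnA -mulnDl leq_mul2r; apply/orP; right.
by nia.
Qed.

End Counting.

Local Open Scope ring_scope.

(** Take an alphabet of exactly [m.+1] letters. There are [m.+1 ^ m.+1] words in all, and each
    pattern is realised by a falling factorial of at least [m.+1] noncrossing words. *)
Lemma sum_ballot_le m : \sum_(v < m.+1) ballot m v 0 <= (m.+1 ^ m)%N%:Z.
Proof.
have : \sum_(v < m.+1) m.+1%:Z * ballot m v 0 <= (m.+1 ^ m.+1)%N%:Z.
  apply: (@le_trans _ _ (\sum_(w : m.+1.-tuple 'I_m.+1 | ncstack w) 1)).
    rewrite (@sum_nc _ int m (fun=> 1)); apply: ler_sum => v _.
    rewrite mulr1 intz ler_wpM2r ?ballot_ge0 //.
    rewrite card_ord natz lez_nat ffactnS -[X in (X <= _)%N]muln1.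
    by rewrite leq_mul2l /= ffact_gt0 -ltnS.
  rewrite sumr_const natz lez_nat; apply: leq_trans (max_card _) _.
  by rewrite card_tuple card_ord.
by rewrite -mulr_sumr expnS PoszM ler_pM2l.
Qed.

(** * Circulations *)

Section Circulation.
Variables (F : fieldType) (V : lmodType F) (n : nat) (h : 'I_n -> V) (T : finType).
Implicit Types (w a b : seq T) (g : T -> F) (x y z : T).

(** The flow equations are tested against an arbitrary potential [g], and the end letter [z] is
    explicit so that walks can be cut and spliced. Closing the walk means taking [z] to be its
    head. *)
Fixpoint circ g w z (t : seq 'I_n) : V :=
  match w, t with
  | x :: w', s :: t' => (g x - g (head z w')) *: h s + circ g w' z t'
  | _, _ => 0
  end.

Definition circulation w t := forall g z, circ g w (head z w) t = 0.

Definition is_circulation l (w : l.-tuple T) (t : {ffun 'I_l -> 'I_n}) : bool :=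
  [forall x, \sum_i ((tnth w i == x)%:R - (tnth w (ordS i) == x)%:R) *: h (t i) == 0].

Lemma circ_cat g a b z (t u : seq 'I_n) : size a = size t ->
  circ g (a ++ b) z (t ++ u) = circ g a (head z b) t + circ g b z u.
Proof.
elim: a t => [|x a IHa] [|s t] //= => [_|[/IHa ->]]; first by rewrite add0r.
by rewrite addrA; case: a {IHa}.
Qed.

Lemma circ_nseq g w z (s : 'I_n) :
  circ g w z (nseq (size w) s) = (g (head z w) - g z) *: h s.
Proof.
elim: w => [|x w IHw] /=; first by rewrite subrr scale0r.
by rewrite IHw -scalerDl subrKA.
Qed.

Lemma circ_nth (s0 : 'I_n) g w z (t : seq 'I_n) : size t = size w ->
  circ g w z t =
    \sum_(i < size w) (g (nth z w i) - g (nth z w i.+1)) *: h (nth s0 t i).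
Proof.
elim: w t => [|x w IHw] [|s t] //= => [_|[E]]; first by rewrite big_ord0.
by rewrite big_ord_recl /= nth0 -IHw.
Qed.

Lemma tnth_ordS l (w : l.-tuple T) z i :
  tnth w (ordS i) = nth (head z w) w i.+1.
Proof.
rewrite (tnth_nth (head z w)) /=; have := ltn_ord i.
rewrite leq_eqVlt => /orP[/eqP E|lt]; last by rewrite modn_small.
by rewrite [RHS]nth_default ?size_tuple ?E // modnn nth0; case: (tval w).
Qed.

Lemma is_circulation_of_seq l (w : l.-tuple T) (s0 : 'I_n) (t : seq 'I_n) :
  size t = l -> circulation w t ->
  is_circulation w [ffun i : 'I_l => nth s0 t i].
Proof.
move=> st ct; apply/forallP => x; apply/eqP.
have := ct (fun y => (y == x)%:R) x; rewrite (circ_nth s0) ?size_tuple // => E.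
rewrite -[RHS]E.
by apply: eq_bigr => i _; rewrite ffunE (tnth_ordS w x) (tnth_nth (head x w)).
Qed.

(** Every potential is a linear combination of indicators of letters, for which the equations hold
    by definition. *)
Lemma is_circulationP l (w : l.-tuple T) t g : is_circulation w t ->
  \sum_i (g (tnth w i) - g (tnth w (ordS i))) *: h (t i) = 0.
Proof.
move/forallP => ct.
have gE y : g y = \sum_x g x * (y == x)%:R.
  by rewrite (bigD1 y) //= eqxx mulr1 big1 ?addr0 // => x /negbTE; rewrite eq_sym => ->; rewrite mulr0.
under eq_bigr => i _ do rewrite (gE (tnth w i)) (gE (tnth w (ordS i))) -sumrB scaler_suml.
rewrite exchange_big big1 //= => x _.
under eq_bigr => i _ do rewrite -mulrBr -scalerA.
by rewrite -scaler_sumr (eqP (ct x)) scaler0.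
Qed.

Lemma circulations_nseq w s : circulation w (nseq (size w) s).
Proof. by move=> g z; rewrite circ_nseq; case: w => [|x w] /=; rewrite subrr scale0r. Qed.

(** The edge from [x] to itself has coefficient [g x - g x = 0], so its label [s] is free. *)
Lemma circulation_loop b x a (t u : seq 'I_n) s r : size b = size t ->
  circulation (b ++ x :: a) (t ++ r :: u) ->
  circulation (b ++ x :: x :: a) (t ++ s :: r :: u).
Proof.
move=> sbt ct g z; rewrite -[RHS](ct g z) !circ_cat //= subrr scale0r add0r.
by case: b sbt ct.
Qed.

(** The edge leaving [y] is subdivided by [x]; giving both halves the label [s] makes the potential
    at [x] cancel. *)
Lemma circulation_single b y x a (t u : seq 'I_n) s : size b = size t ->
  (0 < size a)%N ->
  circulation (b ++ y :: a) (t ++ s :: u) ->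
  circulation (b ++ y :: x :: a) (t ++ s :: s :: u).
Proof.
move=> sbt a0 ct g z; rewrite -[RHS](ct g z) !circ_cat //=.
have -> (c : seq T) : head z (b ++ y :: c) = head y b by case: (b).
case: a a0 ct => // x' a _ _ /=; congr (_ + _).
by rewrite addrA -scalerDl subrKA; case: b sbt.
Qed.

Lemma cat_split_size (b : seq T) y a (t : seq 'I_n) : size t = size (b ++ y :: a) ->
  exists t1 s t2, [/\ t = t1 ++ s :: t2, size b = size t1 & size t2 = size a].
Proof.
rewrite size_cat /= => st.
have lt : (size b < size t)%N by rewrite st; lia.
exists (take (size b) t); case E: (drop (size b) t) => [|s u].
  by have := size_drop (size b) t; rewrite E /=; lia.
exists s, u; split; first by rewrite -E cat_take_drop.
  by rewrite size_take lt.
by have := size_drop (size b) t; rewrite E /= st; lia.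
Qed.

(** By induction along [ncstack_reduce]. Restoring a loop multiplies the number of circulations by
    [n] and keeps the letters; restoring a letter occurring once keeps the number and adds a letter.
    A repetition-free word is a cycle, carrying the [n] constant labellings. *)
Lemma nc_circulations w s : ncstack w = Some s -> (0 < size w)%N ->
  exists L : seq (seq 'I_n),
    [/\ uniq L, size L = (n ^ ((size w).+1 - nvert w))%N
      & forall t, t \in L -> size t = size w /\ circulation w t].
Proof.
move Em : (size w) => m; elim: m w s Em => // m IHm w s Em ncw _.
have [uw|nuw] := boolP (uniq w).
  exists [seq nseq m.+1 i | i <- enum 'I_n].
  rewrite map_inj_uniq ?enum_uniq; last by move=> i j [].
  rewrite size_map size_enum_ord /nvert undup_id // Em subSnn expn1.
  by split=> // t /mapP[i _ ->]; rewrite size_nseq -Em; split=> //; apply: circulations_nseq.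
have [b [y [x [a [Ew ua ya]]]]] := first_repeat nuw.
rewrite Ew in ncw.
have := ncstack_reduce ua ya ncw.
case: eqP => [yx|/eqP yx].
  move=> ncw'; have sw' : size (b ++ x :: a) = m by move: Em; rewrite Ew !size_cat /=; lia.
  have m0 : (0 < m)%N by rewrite -sw' size_cat /=; lia.
  have [L [uL sL circL]] := IHm _ _ sw' ncw' m0.
  pose ins (r : 'I_n * seq 'I_n) := take (size b) r.2 ++ r.1 :: drop (size b) r.2.
  exists [seq ins (i, t) | i <- enum 'I_n, t <- L]; split.
  - apply: allpairs_uniq => //; first exact: enum_uniq.
    move=> [i t] [j u] /allpairsP[[i1 t1] [_ /= t1L [-> ->]]] /allpairsP[[i2 t2] [_ /= t2L [-> ->]]].
    have st v : v \in L -> size (take (size b) v) = size b.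
      move=> /circL [sv _]; rewrite size_take sv; case: ifP => //.
      by rewrite -sw' size_cat /=; lia.
    move/eqP; rewrite /ins /= eqseq_cat ?st // => /andP[/eqP E1 /eqP [-> E2]].
    by rewrite -(cat_take_drop (size b) t1) E1 E2 cat_take_drop.
  - rewrite size_allpairs size_enum_ord sL -expnS; congr (n ^ _)%N.
    have -> : nvert w = nvert (b ++ x :: a).
      rewrite /nvert; apply/eqP; rewrite -uniq_size_uniq ?undup_uniq // => z.
      by rewrite !mem_undup Ew yx !mem_cat !inE; case: eqP.
    by have := nvert_le (b ++ x :: a); rewrite sw'; lia.
  - move=> _ /allpairsP[[i t] [_ /= /circL [st ct] ->]].
    have [t1 [r [t2 [Et sb sa]]]] : exists t1 s t2, [/\ t = t1 ++ s :: t2, size b = size t1 & size t2 = size a].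
      by apply: (@cat_split_size b x a); rewrite st sw'.
    rewrite /ins /= Et sb take_size_cat // drop_size_cat //.
    split; first by rewrite -Em Ew !size_cat /= sb sa.
    by rewrite Ew yx; apply: circulation_loop; rewrite -?Et.
move=> [{}ya xb ncw'].
have sw' : size (b ++ y :: a) = m by move: Em; rewrite Ew !size_cat /=; lia.
have m0 : (0 < m)%N by rewrite -sw' size_cat /=; lia.
have [L [uL sL circL]] := IHm _ _ sw' ncw' m0.
(* The two pieces overlap, so the label at position [size b] is doubled. *)
pose ins (t : seq 'I_n) :=
  take (size b).+1 t ++ drop (size b) t.
exists [seq ins t | t <- L]; split.
- rewrite map_inj_in_uniq // => t u tL uL' /eqP.
  have st v : v \in L -> size (take (size b).+1 v) = (size b).+1.
    move=> /circL [sv _]; rewrite size_take sv; case: ifP => //.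
    by rewrite -sw' size_cat /=; lia.
  rewrite /ins eqseq_cat ?st // => /andP[/eqP E1 /eqP E2].
  rewrite -(cat_take_drop (size b) t) E2.
  have -> : take (size b) t = take (size b) u.
    by rewrite -[LHS](take_takel t (leqnSn _)) E1 take_takel.
  by rewrite cat_take_drop.
- rewrite size_map sL; congr (n ^ _)%N.
  have -> : nvert w = (nvert (b ++ y :: a)).+1.
    have : perm_eq (undup w) (x :: undup (b ++ y :: a)).
      apply: uniq_perm; rewrite ?undup_uniq //=.
        rewrite undup_uniq mem_undup mem_cat inE (negbTE xb) eq_sym (negbTE yx) /= andbT.
        by case/andP: ua.
      by move=> z; rewrite inE !mem_undup Ew !mem_cat !inE; do ![case: eqP => //]; rewrite ?orbT.
    by move/perm_size.
  by have := nvert_le (b ++ y :: a); rewrite sw'; lia.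
- move=> _ /mapP[t /circL [st ct] ->].
  have [t1 [r [t2 [Et sb sa]]]] : exists t1 s t2, [/\ t = t1 ++ s :: t2, size b = size t1 & size t2 = size a].
    by apply: (@cat_split_size b y a); rewrite st sw'.
  have -> : ins t = t1 ++ r :: r :: t2.
    have Etk : take (size t1).+1 (t1 ++ r :: t2) = rcons t1 r.
      by rewrite -cat_rcons take_size_cat ?size_rcons.
    by rewrite /ins Et sb drop_size_cat // Etk cat_rcons.
  split; first by rewrite -Em Ew !size_cat /= sb sa.
  rewrite Ew; apply: circulation_single; rewrite -?Et //.
  by case: (a) ya.
Qed.

Lemma card_circulations_ge l (w : l.-tuple T) : (0 < n)%N -> (0 < l)%N -> ncstack w ->
  (n ^ (l.+1 - nvert w) <= #|[set t | is_circulation w t]|)%N.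
Proof.
move=> n0 l0; case E: (ncstack w) => [s|] // _.
have [|L [uL sL circL]] := nc_circulations E; first by rewrite size_tuple.
rewrite size_tuple in sL circL; rewrite -sL.
pose f (t : seq 'I_n) : {ffun 'I_l -> 'I_n} := [ffun i : 'I_l => nth (Ordinal n0) t i].
have uf : uniq [seq f t | t <- L].
  rewrite map_inj_in_uniq // => t u /circL [st _] /circL [su _] /ffunP ftu.
  apply: (@eq_from_nth _ (Ordinal n0)); first by rewrite st su.
  by move=> i; rewrite st => lt_i; have := ftu (Ordinal lt_i); rewrite !ffunE.
rewrite -(size_map f) -(card_uniqP uf); apply: subset_leq_card; apply/subsetP.
move=> _ /mapP[t /circL [st ct] ->]; rewrite inE.
exact: is_circulation_of_seq.
Qed.

End Circulation.

Lemma card_le_restrict (I B : finType) (S : {set {ffun I -> B}}) (Q : {set I}) :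
  {in S &, forall t u : {ffun I -> B}, {in Q, t =1 u} -> t = u} -> (#|S| <= #|B| ^ #|Q|)%N.
Proof.
move=> injS; pose f (t : {ffun I -> B}) := [ffun i : {x | x \in Q} => t (val i)].
rewrite -(@card_in_imset _ _ f S) => [|t u tS uS /ffunP E].
  by apply: leq_trans (max_card _) _; rewrite card_ffun card_sig.
by apply: injS => // i iQ; have := E (Sub i iQ); rewrite !ffunE.
Qed.

Lemma card_le_fibres (A B : finType) (S : {set A}) (D : {set B}) (f : A -> B) r :
    {in S, forall a, f a \in D} ->
    {in D, forall b, #|[set a in S | f a == b]| <= r}%N ->
  (#|S| <= r * #|D|)%N.
Proof.
move=> fD fib; rewrite -sum1_card (partition_big f (mem D)) //= mulnC -sum_nat_const.
apply: leq_sum => b bD; apply: leq_trans (fib b bD); rewrite -sum1_card leq_eqVlt.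
by apply/orP; left; apply/eqP/eq_bigl => a; rewrite inE.
Qed.

Lemma bool_rise (B : nat -> bool) i j : (i < j)%N -> ~~ B i -> B j ->
  exists k, [/\ (i <= k < j)%N, ~~ B k & B k.+1].
Proof.
move=> lt_ij Bi; elim: j lt_ij => // j IHj; rewrite ltnS leq_eqVlt => /orP[/eqP <- Bj|lt_ij Bj].
  by exists i; rewrite leqnn ltnSn.
have [/IHj -/(_ lt_ij) [k [/andP[ik kj] Bk Bk1]]|nBj] := boolP (B j).
  by exists k; rewrite ik ltnS ltnW.
by exists j; rewrite ltnSn ltnW.
Qed.

(** [U] collects the letters hanging below the letter entered at [e] in the tree of entry edges. It
    is built along the word: a letter read for the first time joins the side of the letter read just
    before it. *)
Lemma fundamental_cut (T : eqType) (z : T) (w : seq T) e : (e.+1 < size w)%N ->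
    nth z w e \notin drop e.+1 w ->
  exists U : pred T, [/\ U (nth z w e), {in drop e.+1 w, forall y, ~~ U y}
    & forall i, i != e -> (i.+1 < size w)%N -> nth z w i \notin drop i.+1 w ->
      U (nth z w i) = U (nth z w i.+1)].
Proof.
elim: w e => // x w IHw [|e] /=; rewrite ltnS.
  rewrite drop0 => w0 xw; exists (pred1 x); split=> [|y yw|[|i] //= _ lt_i _].
  - exact: eqxx.
  - by apply: contraNneq xw => <-.
  - have neqx y : y \in w -> (y == x) = false by move=> yw; apply: contraNF xw => /eqP <-.
    by rewrite !neqx ?mem_nth // ltnW.
move=> lt_e /(IHw _ lt_e) [U [Ue Uafter Uother]].
have [xw|xw] := boolP (x \in w).
  exists U; split=> // -[|i] /= ie lt_i; first by rewrite drop0 xw.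
  exact: Uother.
exists (fun y => if y == x then U (head z w) else U y).
have neqx y : y \in w -> (y == x) = false by move=> yw; apply: contraNF xw => /eqP <-.
split=> [|y yw|[|i] /= ie lt_i].
- by rewrite neqx // mem_nth // ltnW.
- by rewrite neqx; [exact: Uafter | exact: mem_drop yw].
- by move=> _; rewrite eqxx neqx ?nth0 // -nth0 mem_nth.
- by move=> new_i; rewrite !neqx ?mem_nth // 1?ltnW //; apply: Uother.
Qed.

(** * Upper bounds from spanning trees and cuts *)

Section UpperBounds.
Variables (F : fieldType) (V : lmodType F) (n : nat) (h : 'I_n -> V).
Hypothesis h_inj : injective h.
Variables (T : finType) (m : nat) (w : m.+1.-tuple T).
Local Notation z := (head (thead w) w).

(* Positions whose edge does not enter a letter for the first time: they
   complement a spanning tree of the multigraph traced by [w]. *)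
Definition cotree : {set 'I_m.+1} :=
  [set i : 'I_m.+1 | (i.+1 == m.+1) || (nth z w i \in drop i.+1 w)].

Lemma nvert_new (s : seq T) (y : T) :
  nvert s = (\sum_(i < size s) (nth y s i \notin drop i.+1 s))%N.
Proof.
elim: s => [|x s IHs]; first by rewrite big_ord0.
by rewrite nvert_cons big_ord_recl /= drop0 IHs.
Qed.

(** Every letter except the root, the first one read, has one entry edge; this leaves
    [m.+1 - (nvert w - 1)] positions. *)
Lemma card_cotree : #|cotree| = (m.+2 - nvert w)%N.
Proof.
have : (nvert w + #|cotree| = m.+2)%N; last by lia.
rewrite (nvert_new w z) size_tuple -sum1_card.
rewrite [X in (_ + X)%N]big_mkcond -big_split /=.
rewrite big_ord_recr /= inE eqxx drop_oversize ?size_tuple //= addn2; congr _.+2.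
rewrite (eq_bigr (fun=> 1%N)) ?sum_nat_const ?card_ord ?muln1 // => i _.
by rewrite inE /= eqSS ltn_eqF //=; case: (_ \in _).
Qed.

Local Notation sol := [set t | is_circulation h w t].
(** The coefficient of [h (t i)] in the sum of the flow equations over [U]: 1 on edges leaving [U],
    -1 on edges entering it, 0 elsewhere. *)
Local Notation cutc U i := ((U (tnth w i))%:R - (U (tnth w (ordS i)))%:R : F).

Lemma cutcE (U : pred T) (i : 'I_m.+1) :
  cutc U i = (U (nth z w i))%:R - (U (nth z w i.+1))%:R.
Proof. by rewrite (tnth_ordS w (thead w)) (tnth_nth z). Qed.

Lemma tree_cut e : e \notin cotree -> exists U : pred T,
  [/\ cutc U e = 1, U (nth z w e), {in drop e.+1 w, forall y, ~~ U y}
    & forall i, i \notin cotree -> i != e -> cutc U i = 0].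
Proof.
rewrite inE negb_or => /andP[e_lt new_e].
have lt_e : (e.+1 < size w)%N by rewrite size_tuple; have := ltn_ord e; lia.
have [U [Ue Uafter Uother]] := fundamental_cut lt_e new_e.
exists U; split=> // [|i]; rewrite ?cutcE.
  rewrite Ue (negbTE (Uafter _ _)) ?subr0 //.
  by rewrite (drop_nth z lt_e) mem_head.
rewrite inE negb_or => /andP[i_lt new_i] ie; rewrite Uother ?subrr //.
by rewrite size_tuple; have := ltn_ord i; lia.
Qed.

Lemma cut_determines t u (U : pred T) e : t \in sol -> u \in sol ->
  cutc U e != 0 -> (forall i, i != e -> cutc U i != 0 -> t i = u i) -> t e = u e.
Proof.
rewrite !inE => ct cu Ue Etu; apply: h_inj.
have := etrans (is_circulationP (fun y => (U y)%:R) ct)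
  (esym (is_circulationP (fun y => (U y)%:R) cu)).
rewrite (bigD1 e) //= [RHS](bigD1 e) //=.
rewrite [X in _ + X](eq_bigr (fun i => cutc U i *: h (u i))) => [E|i ie].
  exact: (scalerI Ue (addIr _ E)).
by have [->|Ui] := eqVneq (cutc U i) 0; rewrite ?scale0r // Etu.
Qed.

(** The fundamental cut of a tree edge contains no other tree edge, so its equation and the
    injectivity of [h] recover the label there. *)
Lemma cotree_determines (t u : {ffun 'I_m.+1 -> 'I_n}) : t \in sol -> u \in sol ->
  {in cotree, t =1 u} -> t = u.
Proof.
move=> ts us Etu; apply/ffunP => e; have [/Etu //|e_tree] := boolP (e \in cotree).
have [U [Ue _ _ U0]] := tree_cut e_tree.
apply: (@cut_determines _ _ U) => // [|i ie]; first by rewrite Ue oner_neq0.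
by have [/Etu //|i_tree] := boolP (i \in cotree); rewrite U0 ?eqxx.
Qed.

Lemma card_circulations_le : (#|sol| <= n ^ (m.+2 - nvert w))%N.
Proof.
by rewrite -card_cotree -[n in (n ^ _)%N]card_ord; apply: card_le_restrict; apply: cotree_determines.
Qed.

Variable r : nat.
Hypothesis few_differences : forall d : V, d != 0 ->
  (#|[set ab : 'I_n * 'I_n | (h ab.1 - h ab.2 == d)%R]| <= r)%N.

(** Labellings with [t e = t f] contribute the 1 in [r.+1], the others contribute [r]; in both cases
    one cotree label fewer is chosen freely. *)
Lemma card_circulations_cut (U : pred T) e f f' :
  e \notin cotree -> f \in cotree -> f' \in cotree -> f != f' ->
  cutc U e = 1 -> cutc U f = -1 -> cutc U f' = -1 ->
  (forall i, i \notin cotree -> i != e -> cutc U i = 0) ->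
  (#|sol| <= r.+1 * n ^ (m.+1 - nvert w))%N.
Proof.
move=> e_tree f_co f'_co ff' Ue Uf Uf' U0.
have ef : e != f by apply: contraNneq e_tree => ->.
have cardQ i : i \in cotree -> #|cotree :\ i| = (m.+1 - nvert w)%N.
  by move=> i_co; have := cardsD1 i cotree; rewrite i_co card_cotree; lia.
rewrite -(cardsID [set t : {ffun 'I_m.+1 -> 'I_n} | t e == t f] sol) mulSn leq_add //.
  (* When [t e = t f] the terms of [e] and [f] cancel in the cut equation, which then determines the
     label at [f'] from the other cotree labels. *)
  rewrite -(cardQ f') // -[n in (n ^ _)%N]card_ord; apply: card_le_restrict => t u.
  rewrite !in_setI => /andP[ts]; rewrite inE => /eqP tef /andP[us].
  rewrite inE => /eqP uef Etu.
  have Ef : t f = u f by apply: Etu; rewrite in_setD1 ff'.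
  apply: cotree_determines => // i i_co; have [->|if'] := eqVneq i f'; last first.
    by apply: Etu; rewrite in_setD1 if'.
  apply: (@cut_determines _ _ U) => // [|j jf' Uj]; first by rewrite Uf' oppr_eq0 oner_neq0.
  have [->|je] := eqVneq j e; first by rewrite tef uef.
  apply: Etu; rewrite in_setD1 jf' /=; apply: contraNT Uj => j_tree.
  by rewrite U0.
(* When [t e] and [t f] differ, the labels on [Q] fix the nonzero difference [h (t e) - h (t f)],
   which leaves at most [r] pairs; the pair and [Q] then determine [t]. *)
pose Q := cotree :\ f.
pose res (t : {ffun 'I_m.+1 -> 'I_n}) := [ffun i : {x | x \in Q} => t (val i)].
have -> : (n ^ (m.+1 - nvert w))%N = #|[set: {ffun {x | x \in Q} -> 'I_n}]|.
  by rewrite cardsT card_ffun card_sig card_ord cardQ.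
apply: (@card_le_fibres _ _ _ _ res) => [t _|b _]; first by rewrite inE.
set S := [set _ in _ | _].
have [->|[t0 t0S]] := set_0Vmem S; first by rewrite cards0.
have dE t : t \in S -> h (t e) - h (t f) = h (t0 e) - h (t0 f) /\ {in Q, t =1 t0}.
  move: t0S; rewrite !inE => /andP[/andP[_ ct0] /eqP b0] /andP[/andP[_ ct] /eqP bt].
  have EQ : {in Q, t =1 t0}.
    by move=> i iQ; have := congr1 (fun b : {ffun _} => b (Sub i iQ)) (etrans bt (esym b0)); rewrite !ffunE.
  split=> //.
  have := etrans (is_circulationP (fun y => (U y)%:R) ct)
    (esym (is_circulationP (fun y => (U y)%:R) ct0)).
  rewrite (bigD1 e) //= (bigD1 f) ?[f == e]eq_sym //= [RHS](bigD1 e) //= [X in _ = _ + X](bigD1 f) ?[f == e]eq_sym //=.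
  rewrite Ue Uf !scale1r !scaleN1r !addrA.
  rewrite [X in _ + X = _](eq_bigr (fun i => cutc U i *: h (t0 i))) => [E|i /andP[ie jf]].
    exact: addIr E.
  have [i_co|i_tree] := boolP (i \in cotree); last by rewrite U0 // !scale0r.
  by rewrite EQ // in_setD1 jf.
have t0d : h (t0 e) - h (t0 f) != 0.
  move: t0S; rewrite !inE => /andP[/andP[t0ef _] _].
  by rewrite subr_eq0 (inj_eq h_inj).
apply: leq_trans (few_differences t0d).
rewrite -(@card_in_imset _ _ (fun t : {ffun 'I_m.+1 -> 'I_n} => (t e, t f)) S).
  apply: subset_leq_card; apply/subsetP => _ /imsetP[t tS ->]; rewrite inE /=.
  by rewrite (proj1 (dE t tS)).
move=> t u tS uS [_ Ef].
have inS v : v \in S -> v \in sol by rewrite !inE => /andP[/andP[_ ->]].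
apply: cotree_determines; rewrite ?inS // => i i_co.
have [-> //|jf] := eqVneq i f.
by rewrite (proj2 (dE t tS)) ?(proj2 (dE u uS)) // in_setD1 jf.
Qed.

(** The cut is that of the entry edge [e] of [x], so [x] is inside and [y] outside. Along the closed
    walk x..y..x..y the side changes at least four times, giving two distinct edges into [U]; these
    are cotree edges because [e] is the only tree edge of the cut and it leaves [U]. *)
Lemma card_circulations_crossing : ncstack w = None ->
  (#|sol| <= r.+1 * n ^ (m.+1 - nvert w))%N.
Proof.
case/ncstack_None => a [x [a' [y [b [c [Ew yc xc]]]]]].
have sw : size w = m.+1 by rewrite size_tuple.
pose iy := size (a ++ x :: a'); pose ie := size (a ++ x :: a' ++ y :: b).
have Ew2 : tval w = (a ++ x :: a') ++ y :: b ++ x :: c by rewrite Ew -catA.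
have Ew3 : tval w = (a ++ x :: a' ++ y :: b) ++ x :: c by rewrite Ew -!catA /= -catA.
have c0 : (0 < size c)%N by case: (c) yc.
have le_e : (ie.+1 < m.+1)%N.
  by rewrite -sw Ew3 size_cat /= -/ie addnS ltnS -addn1 leq_add2l.
have lt_e : (ie < m.+1)%N by apply: ltnW.
have lt_ye : (iy < ie)%N by rewrite /iy /ie !size_cat /= !size_cat /= ltn_add2l ltnS -addSnnS leq_addr.
have lt_xy : (size a < iy)%N by rewrite /iy size_cat /= -[X in (X < _)%N]addn0 ltn_add2l.
have nth_e : nth z w ie = x by rewrite Ew3 nth_cat ltnn subnn.
have nth_y : nth z w iy = y by rewrite Ew2 nth_cat ltnn subnn.
have nth_x : nth z w (size a) = x by rewrite Ew nth_cat ltnn subnn.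
have drop_e : drop ie.+1 w = c.
  by rewrite Ew3 -cat_rcons drop_size_cat // size_rcons.
pose e := Ordinal lt_e.
have e_tree : e \notin cotree by rewrite inE /= nth_e drop_e negb_or xc eqSS ltn_eqF.
have [U [Ue Uxe Uafter U0]] := tree_cut e_tree.
have {}Uxe : U x by move: Uxe; rewrite nth_e.
have {}Uafter : {in c, forall y, ~~ U y} by move: Uafter; rewrite /= drop_e.
pose Bw i := U (nth z w i).
have rise k : (k < m.+1)%N -> ~~ Bw k -> Bw k.+1 -> k != ie ->
    exists i : 'I_m.+1, [/\ val i = k, cutc U i = -1 & i \in cotree].
  move=> lt_k Bk Bk1 ke; exists (Ordinal lt_k); split=> //.
    by rewrite cutcE /= -/(Bw k) -/(Bw k.+1) (negbTE Bk) Bk1 sub0r.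
  apply/negPn/negP => /U0 /(_ ke); rewrite cutcE /= -/(Bw k) -/(Bw k.+1) (negbTE Bk) Bk1 sub0r.
  by move/eqP; rewrite oppr_eq0 oner_eq0.
have By : ~~ Bw iy by rewrite /Bw nth_y Uafter.
have Be : Bw ie by rewrite /Bw nth_e.
have [k [/andP[yk ke] Bk Bk1]] := bool_rise lt_ye By Be.
have [|f [fk Uf f_co]] := rise k (ltn_trans ke lt_e) Bk Bk1; first by rewrite ltn_eqF.
(* The second entry into [U] lies between the [y] in [c] and the return to the head if the head is
   in [U], and before the leftmost displayed [x] otherwise. *)
have [k' [lt_k' k'e k'k Bk' Bk'1]] : exists k', [/\ (k' < m.+1)%N, k' != ie, k' != k, ~~ Bw k' & Bw k'.+1].
  have [B0|B0] := boolP (Bw 0%N).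
    pose j := (ie.+1 + index y c)%N.
    have lt_j : (j < m.+1)%N.
      by rewrite -sw Ew3 size_cat /= -/ie /j addSnnS ltn_add2l ltnS index_mem.
    have Bj : ~~ Bw j by rewrite /Bw /j -nth_drop drop_e nth_index // Uafter.
    (* Position [m.+1] is past the end, and the default of [nth] there is the head of the word: the
       walk closes up. *)
    have Bl : Bw m.+1.
      have hz : head z w = z by case: (tval w).
      by move: B0; rewrite /Bw nth0 hz [nth _ _ m.+1]nth_default ?sw.
    have [k' [/andP[jk' k'm] Bk' Bk'1]] := bool_rise lt_j Bj Bl.
    have ek' : (ie < k')%N := leq_trans (leq_addr _ _) jk'.
    by exists k'; rewrite !gtn_eqF // (ltn_trans ke).
  have a0 : (0 < size a)%N.
    by rewrite lt0n; apply: contraNneq B0 => E; rewrite -E /Bw nth_x.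
  have [|k' [/andP[_ k'a] Bk' Bk'1]] := bool_rise a0 B0; first by rewrite /Bw nth_x.
  have k'y : (k' < iy)%N := ltn_trans k'a lt_xy.
  have k'e : (k' < ie)%N := ltn_trans k'y lt_ye.
  have k'k : (k' < k)%N := leq_trans k'y yk.
  by exists k'; rewrite !ltn_eqF // (ltn_trans k'e).
have [f' [f'k Uf' f'_co]] := rise k' lt_k' Bk' Bk'1 k'e.
apply: (@card_circulations_cut U e f f') => //.
by rewrite -val_eqE /= fk f'k eq_sym.
Qed.

End UpperBounds.

(** * Dual codewords of weight 4 *)

Section DualCode.
Variables (F : finFieldType) (n k : nat) (C : {vspace 'cV[F]_n}) (H : 'M[F]_(n, k)).
Hypothesis genH : generator_matrix H C.
Hypothesis rowsH : injective (fun t : 'I_n => row t H).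
Local Notation h := (fun t : 'I_n => row t H).

Lemma mem_dual_code (v : 'cV[F]_n) : v^T *m H = 0 -> v \in dual_code C.
Proof.
move=> vH; rewrite inE; apply/forallP => c; apply/implyP => /(proj2 genH) [x ->].
apply/eqP; transitivity ((v^T *m (H *m x)) 0 0); last by rewrite mulmxA vH mul0mx mxE.
by rewrite mxE; apply: eq_bigr => t _; rewrite [v^T 0 t]mxE.
Qed.

Local Notation W4 := [set v in dual_code C | hweight v == 4%N].

Definition quad (a b c d : 'I_n) : 'cV[F]_n :=
  delta_mx a 0 - delta_mx b 0 - delta_mx c 0 + delta_mx d 0.

Lemma quadE a b c d i :
  quad a b c d i 0 = (i == a)%:R - (i == b)%:R - (i == c)%:R + (i == d)%:R.
Proof. by rewrite !mxE !eqxx !andbT. Qed.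

Lemma supp_quad (la : F) a b c d : la != 0 -> uniq [:: a; b; c; d] ->
  [set i | (la *: quad a b c d) i 0 != 0] = [set i in [:: a; b; c; d]].
Proof.
move=> la0 /= u; apply/setP => i; rewrite !inE mxE quadE mulf_eq0 negb_or la0 /=.
move: u; rewrite !inE !negb_or => /and4P[/and3P[ab ac ad] /andP[bc bd] cd _].
have [->|ia] := eqVneq i a.
  by rewrite (negbTE ab) (negbTE ac) (negbTE ad) !subr0 addr0 oner_eq0.
have [->|ib] := eqVneq i b.
  by rewrite (negbTE bc) (negbTE bd) sub0r subr0 addr0 oppr_eq0 oner_eq0.
have [->|ic] := eqVneq i c.
  by rewrite (negbTE cd) !sub0r oppr0 add0r addr0 oppr_eq0 oner_eq0.
by have [_|_] := eqVneq i d; rewrite !subr0 add0r ?oner_eq0 ?eqxx.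
Qed.

Lemma quad_W4 (la : F) a b c d : la != 0 -> uniq [:: a; b; c; d] ->
  row a H - row b H = row c H - row d H -> la *: quad a b c d \in W4.
Proof.
move=> la0 u E; rewrite inE; apply/andP; split; last first.
  by rewrite /hweight supp_quad // cardsE (card_uniqP u).
apply: mem_dual_code; rewrite linearZ /= -scalemxAl.
rewrite /quad !(raddfD, raddfN) /= !trmx_delta !mulmxDl !mulNmx -!rowE.
by rewrite -addrA E [- row c H + _]addrC addrA subrK subrr scaler0.
Qed.

(** Two disjoint representations of [d] give the dual codeword [quad a b c e] of weight 4, together
    with its nonzero multiples. Counting triples (scalar, pair, pair) gives the left side, and each
    codeword arises from at most 16 of them. *)
Lemma card_differences (d : 'rV[F]_k) r : d != 0 ->
  #|[set ab : 'I_n * 'I_n | h ab.1 - h ab.2 == d]| = r ->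
  (#|F|.-1 * (r * (r - 3)) <= 16 * #|W4|)%N.
Proof.
move=> d0; set P := [set ab : 'I_n * 'I_n | _] => Er.
have inP a b : ((a, b) \in P) = (h a - h b == d) by rewrite inE.
have eq1 ab cd : ab \in P -> cd \in P -> ab.1 = cd.1 -> ab = cd.
  case: ab cd => a b [c e]; rewrite !inP /= => /eqP <- /eqP E ac; congr (_, _) => //.
  by apply: rowsH; move: E; rewrite ac => /addrI /oppr_inj ->.
have eq2 ab cd : ab \in P -> cd \in P -> ab.2 = cd.2 -> ab = cd.
  case: ab cd => a b [c e]; rewrite !inP /= => /eqP <- /eqP E be; congr (_, _) => //.
  by apply: rowsH; move: E; rewrite be => /addIr ->.
have neq12 ab : ab \in P -> ab.1 != ab.2.
  by case: ab => a b; rewrite inP /=; apply: contraTneq => ->; rewrite subrr eq_sym.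
pose good (ab cd : 'I_n * 'I_n) := [&& cd.1 != ab.1, cd.1 != ab.2 & cd.2 != ab.1].
pose Z := [set x : F * (('I_n * 'I_n) * ('I_n * 'I_n)) |
  [&& x.1 != 0, x.2.1 \in P, x.2.2 \in P & good x.2.1 x.2.2]].
have cZ : (#|F|.-1 * (r * (r - 3)) <= #|Z|)%N.
  pose Y := [set x : ('I_n * 'I_n) * ('I_n * 'I_n) |
    [&& x.1 \in P, x.2 \in P & good x.1 x.2]].
  have -> : Z = setX [set~ 0] Y by apply/setP => x; rewrite !inE.
  rewrite cardsX cardsC1 leq_mul2l; apply/orP; right.
  have -> : #|Y| = (\sum_(ab in P) #|[set cd in P | good ab cd]|)%N.
    rewrite -sum1_card (eq_bigr (fun ab => \sum_(cd in P | good ab cd) 1)%N); last first.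
      by move=> ab _; rewrite -sum1_card; apply: eq_bigl => cd; rewrite !inE.
    by rewrite pair_big_dep /=; apply: eq_bigl => x; rewrite inE.
  rewrite -[X in (X * _)%N]Er -sum_nat_const; apply: leq_sum => ab abP.
  (* A row and [d] determine the other row of a pair, so each of the three excluded coincidences
     rules out at most one [cd]. The fourth, [cd.2 = ab.2], would force [cd = ab]. *)
  pose B1 := [set cd in P | cd.1 == ab.1]; pose B2 := [set cd in P | cd.1 == ab.2].
  pose B3 := [set cd in P | cd.2 == ab.1].
  have B1_le : (#|B1| <= 1)%N.
    apply/card_le1_eqP => x y /setIdP[xP /eqP Ex] /setIdP[yP /eqP Ey].
    by apply: eq1; rewrite // Ex Ey.
  have B2_le : (#|B2| <= 1)%N.
    apply/card_le1_eqP => x y /setIdP[xP /eqP Ex] /setIdP[yP /eqP Ey].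
    by apply: eq1; rewrite // Ex Ey.
  have B3_le : (#|B3| <= 1)%N.
    apply/card_le1_eqP => x y /setIdP[xP /eqP Ex] /setIdP[yP /eqP Ey].
    by apply: eq2; rewrite // Ex Ey.
  rewrite leq_subLR -Er; apply: (@leq_trans #|(B1 :|: B2 :|: B3) :|: [set cd in P | good ab cd]|).
    apply: subset_leq_card; apply/subsetP => cd cdP.
    have BE (q : pred ('I_n * 'I_n)) : (cd \in [set x in P | q x]) = q cd.
      by rewrite in_set cdP.
    rewrite !in_setU !BE /good.
    by case: eqP => //= _; case: eqP => //= _; case: eqP.
  apply: leq_trans (leq_card_setU _ _) _; rewrite leq_add2r.
  apply: leq_trans (leq_card_setU _ _) _.
  apply: (@leq_trans (2 + 1)) => //; apply: leq_add => //.
  by apply: leq_trans (leq_card_setU _ _) _; apply: (@leq_trans (1 + 1)); rewrite ?leq_add.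
apply: leq_trans cZ _.
pose f (x : F * (('I_n * 'I_n) * ('I_n * 'I_n))) :=
  x.1 *: quad x.2.1.1 x.2.1.2 x.2.2.1 x.2.2.2.
have uZ x : x \in Z -> uniq [:: x.2.1.1; x.2.1.2; x.2.2.1; x.2.2.2].
  case: x => la [[a b] [c e]]; rewrite inE /good /= => /and4P[la0 Pab Pcd /and3P[ca cb ea]].
  rewrite !inE !negb_or (neq12 _ Pab) (neq12 _ Pcd) [a == c]eq_sym [a == e]eq_sym [b == c]eq_sym ca cb ea /= andbT.
  by apply: contraNneq ca => be; have [->] := eq2 _ _ Pab Pcd be.
apply: (@card_le_fibres _ _ _ _ f) => [x xZ|v].
  have u := uZ _ xZ; move: xZ; rewrite inE => /and4P[la0 Pab Pcd _].
  apply: quad_W4 => //; by move: Pab Pcd; rewrite !inE /= => /eqP -> /eqP ->.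
rewrite inE => /andP[_ /eqP v4].
set S := [set _ in _ | _]; pose supp := [set i | v i 0 != 0].
have SE x : x \in S -> [/\ x \in Z, f x = v & supp = [set i in [:: x.2.1.1; x.2.1.2; x.2.2.1; x.2.2.2]]].
  rewrite inE => /andP[xZ /eqP fx]; split=> //; rewrite /supp -fx supp_quad ?uZ //.
  by move: xZ; rewrite inE => /and4P[].
(* In the fibre of [v], the first indices of the two pairs lie in the support of size 4 and
   determine everything: [d] gives the second indices, and the scalar is the entry of [v] at the
   first index. *)
rewrite -(@card_in_imset _ _ (fun x : F * (('I_n * 'I_n) * ('I_n * 'I_n)) => (x.2.1.1, x.2.2.1)) S).
  have -> : 16%N = #|setX supp supp| by rewrite cardsX -/(hweight v) v4.
  apply: subset_leq_card; apply/subsetP => _ /imsetP[x /SE [_ _ E] ->].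
  by rewrite in_setX E !inE !eqxx !orbT.
move=> [la [ab cd]] [la' [ab' cd']] /SE [xZ fx _] /SE [yZ fy _] [] /= Ea Ec.
have ZP x : x \in Z -> x.2.1 \in P /\ x.2.2 \in P by rewrite inE => /and4P[].
have [/= Pab Pcd] := ZP _ xZ; have [/= Pab' Pcd'] := ZP _ yZ.
have Eab := eq1 _ _ Pab Pab' Ea; have Ecd := eq1 _ _ Pcd Pcd' Ec.
have sc l : (l *: quad ab'.1 ab'.2 cd'.1 cd'.2) ab'.1 0 = l.
  have := uZ _ yZ; rewrite /= !inE !negb_or => /and4P[/and3P[ab1 ac ad] _ _ _].
  by rewrite mxE quadE eqxx (negbTE ab1) (negbTE ac) (negbTE ad) !subr0 addr0 mulr1.
rewrite Eab Ecd; congr (_, _).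
move: fx fy; rewrite /f /= Eab Ecd => fx fy.
by rewrite -(sc la) fx -fy sc.
Qed.

Lemma differences_bound : exists r : nat,
  (forall d : 'rV[F]_k, d != 0 ->
    (#|[set ab : 'I_n * 'I_n | (h ab.1 - h ab.2 == d)%R]| <= r)%N) /\
  (#|F|.-1 * (r * (r - 3)) <= 16 * #|W4|)%N.
Proof.
exists (\max_(d : 'rV[F]_k | d != 0%R)
  #|[set ab : 'I_n * 'I_n | (h ab.1 - h ab.2 == d)%R]|)%N.
split=> [d d0|]; first exact: leq_bigmax_cond.
elim/big_ind: _ => [|r s|d d0]; first by rewrite muln0.
  by rewrite /maxn; case: ifP.
exact: card_differences d0 erefl.
Qed.

End DualCode.

(** * Character sums *)

Local Open Scope complex_scope.

Section AdditiveCharacter.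
Variables (R : realType) (F : finFieldType) (ell : nat) (charF : ell \in [pchar F]).

Let ell_prime : prime ell := pcharf_prime charF.

Lemma ftraceD : {morph ftrace charF : x y / x + y}.
Proof.
move=> x y; apply: (fmorph_inj (in_alg (pPrimeCharType charF))).
by rewrite rmorphD /= !ftraceP raddfD.
Qed.

(** By Dedekind's independence of automorphisms, their sum is not the zero map. *)
Lemma ftrace_neq0 : exists z, ftrace charF z != 0.
Proof.
apply/existsP; apply: contraT; rewrite negb_exists => /forallP /= tr0.
have indep := @gal_independent _ (pPrimeCharType charF) {: pPrimeCharType charF}%AS
  (mem 'Gal({: pPrimeCharType charF} / 1)%g) (fun=> 1).
suff /indep /(_ 1%g (group1 _)) /eqP : forall a : pPrimeCharType charF,
    a \in {: pPrimeCharType charF}%AS ->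
    \sum_(x in 'Gal({: pPrimeCharType charF} / 1)%g) 1 * x a = 0.
  by rewrite oner_eq0.
move=> a _; under eq_bigr do rewrite mul1r.
have := ftraceP charF a; have := tr0 a; rewrite negbK => /eqP ->.
by rewrite scale0r /galTrace => <-.
Qed.

Lemma expiD (x y : R) : expi (x + y) = expi x * expi y.
Proof. by rewrite /expi cosD sinD; simpc; congr (_ +i* _); ring. Qed.

Definition root_ell (k : nat) : R[i] := expi (2 * pi * k%:R / ell%:R).

Lemma root_ellD j k : root_ell (j + k)%N = root_ell j * root_ell k.
Proof. by rewrite /root_ell -expiD natrD mulrDr mulrDl. Qed.

Lemma root_ell0 : root_ell 0 = 1.
Proof. by rewrite /root_ell mulr0 mul0r /expi cos0 sin0. Qed.

Lemma root_ell_period : root_ell ell = 1.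
Proof.
rewrite /root_ell mulfK ?pnatr_eq0 -?lt0n ?prime_gt0 // /expi mulr_natl cos2pi.
by rewrite mulr2n sinD sinpi mulr0 mul0r addr0.
Qed.

Lemma root_ell_mod k : root_ell (k %% ell)%N = root_ell k.
Proof.
rewrite [in RHS](divn_eq k ell) root_ellD; elim: (k %/ ell)%N => [|d IHd].
  by rewrite mul0n root_ell0 mul1r.
by rewrite mulSn root_ellD root_ell_period mul1r.
Qed.

Lemma psiD : {morph psi R charF : x y / x + y >-> x * y}.
Proof.
move=> x y; rewrite /psi ftraceD -!/(root_ell _) -root_ellD -[RHS]root_ell_mod.
by congr root_ell; rewrite /= -[X in _ = (_ %% X)%N](Fp_cast ell_prime).
Qed.

Lemma psi0 : psi R charF 0 = 1.
Proof.
have -> : psi R charF 0 = root_ell (ftrace charF 0) by [].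
have -> : ftrace charF 0 = 0 by apply: (addrI (ftrace charF 0)); rewrite -ftraceD !addr0.
exact: root_ell0.
Qed.

Lemma psi_conj z : Num.conj (psi R charF z) = psi R charF (- z).
Proof.
have E : psi R charF z * psi R charF (- z) = 1 by rewrite -psiD subrr psi0.
have N : psi R charF z * Num.conj (psi R charF z) = 1.
  by rewrite -normCK normc_def /= cos2Dsin2 sqrtr1 expr1n.
have z0 : psi R charF z != 0 by apply: contra_eq_neq E => ->; rewrite mul0r eq_sym oner_eq0.
by apply: (mulfI z0); rewrite N E.
Qed.

Lemma psi_nontrivial : exists z, psi R charF z != 1.
Proof.
have [z tz] := ftrace_neq0; exists z.
rewrite /psi; set k := (ftrace charF z : nat).
have k0 : (0 < k)%N by rewrite lt0n.
have kl : (k < ell)%N by rewrite -[X in (_ < X)%N](Fp_cast ell_prime) ltn_ord.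
have l0 : 0 < ell%:R :> R by rewrite ltr0n prime_gt0.
have k0R : 0 < k%:R :> R by rewrite ltr0n.
have pi0 := pi_gt0 R.
(* With [x] half the argument, the real part is 1 - 2 sin(x)^2, which is below 1 because 0 < x <
   pi. *)
pose x : R := pi * k%:R / ell%:R.
have x0 : 0 < x by rewrite divr_gt0 ?mulr_gt0.
have xpi : x < pi by rewrite ltr_pdivrMr // ltr_pM2l // ltr_nat.
have sx : 0 < sin x by rewrite sin_gt0_pi // x0.
have -> : 2 * pi * k%:R / ell%:R = x *+ 2 by rewrite -mulr_natl /x; field; rewrite gt_eqF.
rewrite eq_complex /= negb_and cos_mulr2n cos2sin2; apply/orP; left.
rewrite lt_eqF //.
have : 0 < sin x ^+ 2 by rewrite exprn_gt0.
by rewrite mulrnBl; lra.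
Qed.

End AdditiveCharacter.

(** * Traces of matrix powers as sums over closed walks *)

Section TracePower.
Variables (K : comPzRingType) (p : nat) (M : 'M[K]_p).

Fixpoint walk_weight (i : 'I_p) (w : seq 'I_p) (j : 'I_p) : K :=
  if w is x :: w' then M i x * walk_weight x w' j else M i j.

Lemma expmx_walks m i j :
  (M ^+ m.+1) i j = \sum_(w : m.-tuple 'I_p) walk_weight i w j.
Proof.
elim: m i => [|m IHm] i.
  rewrite expr1 (big_pred1 [tuple]) // => w.
  by apply/esym/eqP; rewrite [w]tuple0.
rewrite exprS -mulmxE mxE (@big_tuple_cons _ _ _ _ m (fun w => walk_weight i w j)).
rewrite exchange_big; apply: eq_bigr => x _ /=.
by rewrite IHm mulr_sumr.
Qed.

Lemma walk_weight_prod i w j :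
  walk_weight i w j = \prod_(k < (size w).+1) M (nth j (i :: w) k) (nth j (i :: w) k.+1).
Proof.
elim: w i => [|x w IHw] i /=; first by rewrite big_ord_recl big_ord0 mulr1.
by rewrite big_ord_recl IHw.
Qed.

Lemma trace_expn m : \tr (M ^+ m.+1) =
  \sum_(w : m.+1.-tuple 'I_p) \prod_i M (tnth w i) (tnth w (ordS i)).
Proof.
pose G (s : seq 'I_p) := if s is x :: s' then walk_weight x s' x else 1.
transitivity (\sum_(w : m.+1.-tuple 'I_p) G w).
  rewrite (@big_tuple_cons _ _ _ _ m G) exchange_big.
  by apply: eq_bigr => x _ /=; rewrite expmx_walks.
apply: eq_bigr => w _; case/tupleP: w => x w /=.
rewrite walk_weight_prod [in LHS]size_tuple; apply: eq_bigr => k _.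
by rewrite (tnth_ordS _ x) (tnth_nth x).
Qed.

End TracePower.

(** * Averaging over the code *)

Section Expectation.
Variables (R : realType) (F : finFieldType) (ell : nat) (charF : ell \in [pchar F]).
Variables (n k : nat) (C : {vspace 'cV[F]_n}) (H : 'M[F]_(n, k)).
Hypothesis genH : generator_matrix H C.
Local Notation D := (epsilon_code R charF C).
Local Notation eps x := (epsilon R charF (H *m x)).

Lemma epsilon_codeP u : reflect (exists x, u = eps x) (u \in D).
Proof.
apply: (iffP (imfsetP _ _ _ _)) => [[c /=]|[x ->]].
  by rewrite inE => /(proj2 genH) [x ->] ->; exists x.
by exists (H *m x) => //=; rewrite inE; apply/(proj2 genH); exists x.
Qed.

Lemma epsE x t : eps x t 0 = psi R charF ((H *m x) t 0).
Proof. by rewrite [LHS]mxE. Qed.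

Lemma epsD x y t : eps (x + y) t 0 = eps x t 0 * eps y t 0.
Proof. by rewrite !epsE mulmxDr [X in psi _ _ X]mxE psiD. Qed.

Lemma card_epsilon_code_gt0 : (0 < #|{: D}|)%N.
Proof.
have e0 : eps 0 \in D by apply/epsilon_codeP; exists 0.
by apply/card_gt0P; exists [` e0]%fset.
Qed.

(** For nonzero [g] some [x0] has [psi] of [g *m x0] different from 1. Multiplication by [eps x0]
    permutes [D] and multiplies the sum by that value, so the sum vanishes. *)
Lemma character_sum (X : 'cV[R[i]]_n -> R[i]) (g : 'rV[F]_k) :
  (forall x, X (eps x) = psi R charF ((g *m x) 0 0)) ->
  \sum_(u : D) X (val u) = (g == 0)%:R * #|{: D}|%:R.
Proof.
move=> Xpsi; have [gE|g0] := eqVneq g 0.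
  rewrite mul1r -sum1_card natr_sum; apply: eq_bigr => u _.
  have /epsilon_codeP [x ->] := valP u.
  by rewrite Xpsi gE mul0mx mxE psi0.
rewrite mul0r.
have [z z1] := psi_nontrivial R charF.
have [j gj] : exists j, g 0 j != 0.
  apply/existsP; apply: contraNT g0; rewrite negb_exists => /forallP g0.
  apply/eqP/rowP => j; rewrite mxE; apply/eqP; have := g0 j; by rewrite negbK.
pose x0 : 'cV[F]_k := (z / g 0 j) *: delta_mx j 0.
have gx0 : (g *m x0) 0 0 = z.
  by rewrite -scalemxAr -colE !mxE mulfVK.
pose prod (u : 'cV[R[i]]_n) : 'cV[R[i]]_n := \col_t (eps x0 t 0 * u t 0).
have pE u t : prod u t 0 = eps x0 t 0 * u t 0 by rewrite [LHS]mxE.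
have prodE x : prod (eps x) = eps (x0 + x) by apply/colP => t; rewrite [RHS]epsD pE.
pose sh (u : D) : D := insubd u (prod (val u)).
have shE u : val (sh u) = prod (val u).
  have /epsilon_codeP [x Ex] := valP u.
  by rewrite insubdK // Ex prodE; apply/epsilon_codeP; exists (x0 + x).
have shI : injective sh.
  move=> u v /(congr1 val); rewrite !shE => /colP E; apply: val_inj; apply/colP => t.
  have := E t; rewrite !pE => /mulfI; apply.
  have : psi R charF ((H *m x0) t 0) * psi R charF (- (H *m x0) t 0) = 1.
    by rewrite -psiD subrr psi0.
  rewrite epsE.
  by apply: contra_eq_neq => ->; rewrite mul0r eq_sym oner_eq0.
have : \sum_(u : D) X (val u) = psi R charF z * \sum_(u : D) X (val u).
  rewrite mulr_sumr (reindex_inj shI); apply: eq_bigr => u _; rewrite shE.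
  have /epsilon_codeP [x ->] := valP u.
  by rewrite prodE !Xpsi mulmxDr mxE psiD gx0.
move/eqP; rewrite -[X in X == _]mul1r -subr_eq0 -mulrBl mulf_eq0 subr_eq0 eq_sym (negbTE z1) /=.
by move/eqP.
Qed.

Variable p : nat.
Local Notation h := (fun t : 'I_n => row t H).

(** Collects the factors of a product of Gram entries that involve the vector [u] chosen at [x]:
    edges leaving [x] contribute entries of [u], edges entering it their conjugates. *)
Definition letter_char m (w : m.+1.-tuple 'I_p) (t : {ffun 'I_m.+1 -> 'I_n})
    (x : 'I_p) (u : 'cV[R[i]]_n) : R[i] :=
  (\prod_(i | tnth w i == x) u (t i) 0) * \prod_(i | tnth w (ordS i) == x) (u (t i) 0)^*.

Lemma letter_char_eps m (w : m.+1.-tuple 'I_p) t x y :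
  letter_char w t x (eps y) = psi R charF
    (((\sum_i ((tnth w i == x)%:R - (tnth w (ordS i) == x)%:R) *: h (t i)) *m y) 0 0).
Proof.
have sumE (P : pred 'I_m.+1) : \prod_(i | P i) psi R charF ((H *m y) (t i) 0) =
    psi R charF (\sum_i (P i)%:R * (H *m y) (t i) 0).
  rewrite (big_morph _ (psiD R charF) (psi0 R charF)) big_mkcond; apply: eq_bigr => i _.
  by case: (P i); rewrite ?mul1r // mul0r psi0.
have hE t' : (row t' H *m y) 0 0 = (H *m y) t' 0 by rewrite -row_mul mxE.
have negE (P : pred 'I_m.+1) : \prod_(i | P i) psi R charF (- (H *m y) (t i) 0) =
    psi R charF (- \sum_i (P i)%:R * (H *m y) (t i) 0).
  rewrite -sumrN (big_morph _ (psiD R charF) (psi0 R charF)) big_mkcond; apply: eq_bigr => i _.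
  by case: (P i); rewrite ?mul1r // mul0r oppr0 psi0.
rewrite /letter_char.
rewrite (eq_bigr _ (fun i _ => epsE y (t i))).
rewrite [X in _ * X](eq_bigr (fun i => psi R charF (- (H *m y) (t i) 0))); last first.
  by move=> i _; rewrite epsE psi_conj.
rewrite sumE negE -psiD -sumrB; congr psi.
rewrite mulmx_suml summxE; apply: eq_bigr => i _.
by rewrite -scalemxAl [RHS]mxE hE mulrBl.
Qed.

(** The vectors at different letters are independent, so the sum factors over letters; each factor
    vanishes unless the flow balances at that letter. *)
Lemma sum_letter_char m (w : m.+1.-tuple 'I_p) t :
  \sum_(s : Omega p D) \prod_x letter_char w t x (val (s x)) =
    (is_circulation h w t)%:R * #|{: D}|%:R ^+ p.
Proof.
rewrite -(bigA_distr_bigA (fun x (u : D) => letter_char w t x (val u))).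
under eq_bigr => x _ do rewrite (character_sum (letter_char_eps w t x)).
rewrite big_split /= prodr_const card_ord; congr (_ * _).
rewrite /is_circulation; case: forallP => [circ|ncirc].
  by rewrite big1 // => x _; rewrite circ.
have [x nx] : exists x, \sum_i ((tnth w i == x)%:R - (tnth w (ordS i) == x)%:R) *: h (t i) != 0.
  apply/existsP; apply: contraT; rewrite negb_exists => /forallP /= E.
  by case: ncirc => x; have := E x; rewrite negbK.
by rewrite (bigD1 x) //= (negbTE nx) mul0r.
Qed.

Lemma prod_gram m (w : m.+1.-tuple 'I_p) (s : Omega p D) :
  \prod_i gram s (tnth w i) (tnth w (ordS i)) =
    n%:R ^- m.+1 * \sum_t \prod_x letter_char w t x (val (s x)).
Proof.
under eq_bigr do rewrite mxE.
rewrite big_split /= prodr_const card_ord exprVn mulrC; congr (_ * _).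
rewrite /Defs.hermitian bigA_distr_bigA; apply: eq_bigr => t _.
rewrite [RHS]big_split big_split /=; congr (_ * _).
  rewrite (partition_big (fun i => tnth w i) predT) //=; apply: eq_bigr => x _.
  by apply: eq_bigr => i /eqP <-.
rewrite (partition_big (fun i => tnth w (ordS i)) predT) //=; apply: eq_bigr => x _.
by apply: eq_bigr => i /eqP <-.
Qed.

Lemma expectation_moment m :
  expectation (fun s : Omega p D => moment m.+1 s) =
    (\sum_(w : m.+1.-tuple 'I_p) #|[set t | is_circulation h w t]|)%N%:R
      / (p%:R * n%:R ^+ m.+1).
Proof.
have D0 : #|{: D}|%:R ^+ p != 0 :> R[i].
  by rewrite expf_neq0 // pnatr_eq0 -lt0n card_epsilon_code_gt0.
rewrite /expectation /moment -mulr_suml.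
under eq_bigr do rewrite trace_expn.
rewrite exchange_big /=.
rewrite (eq_bigr (fun w : m.+1.-tuple 'I_p => #|[set t | is_circulation h w t]|%:R *
    (n%:R ^- m.+1 * #|{: D}|%:R ^+ p))); last first.
  move=> w _; rewrite (eq_bigr _ (fun s _ => prod_gram w s)) -mulr_sumr exchange_big /=.
  rewrite (eq_bigr _ (fun t _ => sum_letter_char w t)) -mulr_suml mulrCA; congr (_ * _).
  rewrite -sum1_card natr_sum [RHS]big_mkcond; apply: eq_bigr => t _.
  by rewrite inE; case: ifP.
rewrite card_ffun card_ord natrX -mulr_suml natr_sum invfM -!mulrA; congr (_ * _).
by rewrite [X in _ * X]mulrCA divff // mulr1 mulrC.
Qed.

End Expectation.

(** * Error estimates *)

(** Passing from [v] to [v.+1] adds a loss of at most [v.+1 * p ^ v], and v^2 + v + 1 <= (v +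
    1)^2. *)
Lemma expn_le_ffact p v : (p ^ v <= p.-1 ^_ v + v * v * p ^ v.-1)%N.
Proof.
elim: v => [|v IHv]; first by rewrite expn0 ffactn0.
have X_le : (p.-1 ^_ v <= p ^ v)%N.
  elim: v {IHv} => [|v IHv]; first by rewrite ffactn0.
  by rewrite ffactnSr expnSr leq_mul // (leq_trans (leq_subr _ _)) // leq_pred.
have vE : (v * v * p ^ v.-1 * p = v * v * p ^ v)%N.
  by case: v {IHv X_le} => [|v]; rewrite ?mul0n //= -mulnA -expnSr.
rewrite ffactnSr expnSr /= -subn1.
move: IHv X_le vE; rewrite -subn1; set X := (_ ^_ v)%N; set Y := (p ^ v)%N; set Z := (p ^ v.-1)%N.
move=> h1 h2 h3; have h4 : (Y * p <= X * p + v * v * Y)%N.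
  by rewrite -h3 -mulnDl leq_mul2r h1 orbT.
have h5 : (X * p <= X * (p - 1 - v) + X * v.+1)%N.
  by rewrite -mulnDr leq_mul2l; apply/orP; right; lia.
have h6 : (X * v.+1 <= Y * v.+1)%N by rewrite leq_mul2r h2 orbT.
have h7 : (Y * v.+1 + v * v * Y <= v.+1 * v.+1 * Y)%N.
  by rewrite [(Y * _)%N]mulnC -mulnDl leq_mul2r; apply/orP; right; lia.
lia.
Qed.

Lemma fact_le_expn j b : (j < b)%N -> (j.+1`! <= b ^ j)%N.
Proof.
elim: j => // j IHj jb; rewrite factS expnS leq_mul //.
by apply: IHj; apply: ltnW.
Qed.

Section Estimates.
Variables (R : realType) (F : finFieldType) (n k : nat) (H : 'M[F]_(n, k)).
Hypothesis rowsH : injective (fun t : 'I_n => row t H).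
Variables p m : nat.
Hypotheses (p_gt0 : (0 < p)%N) (le_pn : (p <= n)%N).
Local Notation h := (fun t : 'I_n => row t H).
Local Notation W w := #|[set t | is_circulation h w t]|.
Local Notation y := (p%:R / n%:R : R).
Local Notation l := m.+1.

Let n_gt0 : (0 < n)%N. Proof. exact: leq_trans p_gt0 le_pn. Qed.
Let nR_gt0 : 0 < n%:R :> R. Proof. by rewrite ltr0n. Qed.
Let pR_gt0 : 0 < p%:R :> R. Proof. by rewrite ltr0n. Qed.

Lemma card_circulations_nc (w : l.-tuple 'I_p) : ncstack w ->
  W w = (n ^ (m.+2 - nvert w))%N.
Proof.
move=> ncw; apply/eqP; rewrite eqn_leq card_circulations_le //=.
exact: card_circulations_ge.
Qed.

(** One factor [p] of the falling factorial cancels against the denominator, whence [p.-1 ^_ v]. *)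
Lemma nc_contribution :
  (\sum_(w : l.-tuple 'I_p | ncstack w) W w)%N%:R / (p%:R * n%:R ^+ l) =
    \sum_(v < l) (ballot m v 0)%:~R * ((p.-1 ^_ v)%:R / n%:R ^+ v) :> R.
Proof.
rewrite (eq_bigr (fun w : l.-tuple 'I_p => n ^ (m.+2 - nvert w))%N); last first.
  by move=> w; apply: card_circulations_nc.
rewrite natr_sum (@sum_nc _ R m (fun v => (n ^ (m.+2 - v))%N%:R)) mulr_suml.
apply: eq_bigr => v _; rewrite card_ord ffactnS natrM subSS natrX.
have vm : (v <= m.+1)%N by apply: ltnW.
have -> : n%:R ^+ m.+1 = n%:R ^+ (m.+1 - v) * n%:R ^+ v :> R by rewrite -exprD subnK.
have N1 : n%:R ^+ (m.+1 - v) != 0 :> R by rewrite expf_neq0 // gt_eqF.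
have N2 : n%:R ^+ v != 0 :> R by rewrite expf_neq0 // gt_eqF.
by field; rewrite N1 N2 gt_eqF.
Qed.

Lemma ballotR v : (ballot m v 0)%:~R = 'C(l, v)%:R * 'C(m, v)%:R / v.+1%:R :> R.
Proof.
apply: (mulIf (_ : v.+1%:R != 0)); first by rewrite pnatr_eq0.
rewrite divfK ?pnatr_eq0 // mulrC.
have := congr1 (fun x : int => x%:~R : R) (ballot_diag m v).
by rewrite !intrM.
Qed.

(** Replacing [p.-1 ^_ v] by [p ^ v] costs at most l^2/n in each term after division by n^v, and by
    [sum_ballot_le] the coefficients sum to at most l^(l-1). *)
Lemma nc_error :
  `| (\sum_(w : l.-tuple 'I_p | ncstack w) W w)%N%:R / (p%:R * n%:R ^+ l)
     - \sum_(0 <= i < l) y ^+ i / i.+1%:R * 'C(l, i)%:R * 'C(m, i)%:R |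
    <= (l ^ l.+1)%:R / n%:R :> R.
Proof.
rewrite nc_contribution big_mkord -sumrB.
apply: le_trans (ler_norm_sum _ _ _) _.
apply: (@le_trans _ _ (\sum_(v < l) (ballot m v 0)%:~R * ((l * l)%:R / n%:R))).
  apply: ler_sum => v _.
  have b0 : 0 <= (ballot m v 0)%:~R :> R by rewrite ler0z ballot_ge0.
  have -> : y ^+ v / v.+1%:R * 'C(l, v)%:R * 'C(m, v)%:R = (ballot m v 0)%:~R * (p%:R ^+ v / n%:R ^+ v).
    by rewrite ballotR expr_div_n; ring.
  rewrite -mulrBr normrM (ger0_norm b0) ler_wpM2l // -mulrBl normrM [X in _ * X <= _]ger0_norm; last first.
    by rewrite invr_ge0 exprn_ge0 // ltW.
  rewrite ler_pdivrMr ?exprn_gt0 //.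
  have ffle : (p.-1 ^_ v <= p ^ v)%N.
    elim: (v : nat) => [|u IHu]; first by rewrite ffactn0.
    by rewrite ffactnSr expnSr leq_mul // (leq_trans (leq_subr _ _)) // leq_pred.
  have := expn_le_ffact p v; rewrite -(ler_nat R) natrD !natrM !natrX => ub.
  rewrite distrC ger0_norm ?subr_ge0 -?natrX ?ler_nat // natrX.
  apply: (@le_trans _ _ (v%:R * v%:R * p%:R ^+ v.-1)); first by rewrite lerBlDl.
  case: v {b0 ffle ub} => -[|v] vl /=; first by rewrite !mul0r !mulr_ge0 ?invr_ge0 ?exprn_ge0 // ltW.
  rewrite expnS natrM mulrA divfK ?gt_eqF // -!natrX -!natrM ler_nat.
  have pvn : (p ^ v <= n ^ v)%N by case: (v) => // u; rewrite leq_exp2r.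
  by rewrite !leq_mul // ltnW.
rewrite -mulr_suml mulrA.
rewrite ler_pM2r ?invr_gt0 // -rmorph_sum /=.
have : (\sum_(v < l) ballot m v 0)%:~R <= ((l ^ m)%N%:Z)%:~R :> R.
  by rewrite ler_int sum_ballot_le.
have -> : (l ^ l.+1)%:R = (l ^ m)%:R * (l * l)%:R :> R by rewrite -natrM !expnSr mulnA.
by move=> le_b; rewrite ler_wpM2r.
Qed.

Variable r : nat.
Hypothesis few_differences : forall d : 'rV[F]_k, d != 0 ->
  (#|[set ab : 'I_n * 'I_n | (h ab.1 - h ab.2 == d)%R]| <= r)%N.

(** Combines the saved factor [n] with [sum_nvert_le] and l! <= l^(l-1). *)
Lemma crossing_error :
  (\sum_(w : l.-tuple 'I_p | ~~ ncstack w) W w)%N%:R / (p%:R * n%:R ^+ l)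
    <= (r.+1 * l ^ m)%:R / n%:R :> R.
Proof.
rewrite ler_pdivrMr ?mulr_gt0 ?exprn_gt0 //.
have -> : (r.+1 * l ^ m)%:R / n%:R * (p%:R * n%:R ^+ l) = (r.+1 * l ^ m * (p * n ^ m))%N%:R :> R.
  by rewrite !natrM !natrX exprS; field; rewrite gt_eqF.
rewrite ler_nat.
apply: (@leq_trans (\sum_(w : l.-tuple 'I_p | ~~ ncstack w) r.+1 * n ^ (l - nvert w))%N).
  apply: leq_sum => w; case E: (ncstack w) => [|] // _.
  exact: card_circulations_crossing.
rewrite -big_distrr /= -mulnA leq_mul2l; apply/orP; right.
apply: (@leq_trans (\sum_(w : l.-tuple 'I_p) n ^ (l - nvert w))%N).
  by rewrite [leqRHS](bigID (fun w : l.-tuple 'I_p => ~~ ncstack w)) /= leq_addr.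
have := @sum_nvert_le 'I_p m n; rewrite card_ord => /(_ le_pn) le_sum.
apply: leq_trans le_sum _; rewrite leq_mul2r; apply/orP; right.
exact: fact_le_expn.
Qed.

End Estimates.

(** Writing s for the square root, r > 3 gives (r-3)^2 <= r(r-3) <= 8(s^2 - 1/4) <= (3s)^2; the
    summand 3 also covers r <= 3. *)
Lemma differences_le (R : realType) (q A r : nat) : (1 < q)%N ->
  (q.-1 * (r * (r - 3)) <= 16 * A)%N ->
  r%:R <= 3 + 3 * Num.sqrt (2 * A%:R / (q%:R - 1) + 1 / 4) :> R.
Proof.
move=> q1 le_r; set s := Num.sqrt _.
have s0 : 0 <= s by apply: sqrtr_ge0.
have [r3|r3] := leqP r 3.
  by apply: (@le_trans _ _ 3); [rewrite (ler_nat _ r 3) | rewrite lerDl mulr_ge0].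
have qR : 0 < q%:R - 1 :> R by rewrite subr_gt0 ltr1n.
have s2 : s ^+ 2 = 2 * A%:R / (q%:R - 1) + 1 / 4.
  by rewrite sqr_sqrtr // addr_ge0 // ?divr_ge0 ?mulr_ge0 // ltW.
have le1 : (q%:R - 1) * (r%:R * (r%:R - 3)) <= 16 * A%:R :> R.
  move: le_r; rewrite -(ler_nat R) !natrM natrB; last exact: ltnW.
  by rewrite -subn1 natrB // ltnW.
have r3R : 3 < r%:R :> R by rewrite (ltr_nat _ 3).
have le2 : r%:R * (r%:R - 3) <= 8 * (2 * A%:R / (q%:R - 1)) :> R.
  rewrite [leRHS](_ : _ = 16 * A%:R / (q%:R - 1)); last by field; rewrite gt_eqF.
  by rewrite ler_pdivlMr // mulrC.
have le3 : (r%:R - 3) ^+ 2 <= (3 * s) ^+ 2 by rewrite exprMn s2; nra.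
have : r%:R - 3 <= 3 * s.
  by rewrite -(ler_pXn2r (_ : 0 < 2)%N) ?nnegrE ?mulr_ge0 // subr_ge0 ltW.
by lra.
Qed.

Theorem theorem2p1 (R : realType)
    (F : finFieldType) (ell : nat) (charF : ell \in [pchar F])
    (n k d : nat) (C : {vspace 'cV[F]_n}) (H : 'M[F]_(n, k))
    (codeC : linear_code C k d) (genH : generator_matrix H C)
    (rowsH : injective (fun t : 'I_n => row t H))
    (p : nat) (p_gt0 : (0 < p)%N) (p_lt_n : (p < n)%N) :
  let q := #|F| in
  let y : R := p%:R / n%:R in
  let A := #|[set v in dual_code C | hweight v == 4%N]| in
  let D := epsilon_code R charF C in
  forall l : nat, (2 <= l)%N -> l%:R < Num.sqrt p%:R :> R ->
  exists E : R[i],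
    expectation (fun s : Omega p D => moment l s) =
      (\sum_(0 <= i < l) y ^+ i / i.+1%:R * 'C(l, i)%:R * 'C(l.-1, i)%:R)%:C + E
    /\ `|E| <= ((4 + 2 * Num.sqrt (2 * A%:R / (q%:R - 1) + 1 / 4)) *
                (l ^ l.+1)%:R / n%:R)%:C.
Proof.
move=> q y A D [//|m] l2 _; set main := \sum_(0 <= i < m.+1) _.
have le_pn : (p <= n)%N := ltnW p_lt_n.
have [r [few_d le_r]] := differences_bound genH rowsH.
pose W (w : m.+1.-tuple 'I_p) := #|[set t | is_circulation (fun t : 'I_n => row t H) w t]|.
pose e : R := (\sum_(w : m.+1.-tuple 'I_p) W w)%N%:R / (p%:R * n%:R ^+ m.+1) - main.
exists e%:C; split.
  rewrite (expectation_moment R charF genH) -rmorphD /e addrC subrK.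
  by rewrite rmorphM fmorphV rmorphM rmorphXn !rmorph_nat.
rewrite normc_def /= expr0n addr0 sqrtr_sqr lecR.
have n0 : 0 < n%:R :> R by rewrite ltr0n (leq_trans p_gt0).
have err1 := nc_error R rowsH m p_gt0 le_pn.
have err2 := crossing_error R rowsH m p_gt0 le_pn few_d.
have s_ge0 := sqrtr_ge0 (2 * A%:R / (q%:R - 1) + 1 / 4 : R).
have := differences_le R (finNzRing_gt1 F) le_r.
rewrite -/q -/A; set s := Num.sqrt _ in s_ge0 * => r_le.
move: err1 err2; rewrite -/main -/W.
set N1 := (\sum_(w | ncstack _) _)%N; set N2 := (\sum_(w | ~~ _) _)%N => err1 err2.
have -> : e = N1%:R / (p%:R * n%:R ^+ m.+1) - main + N2%:R / (p%:R * n%:R ^+ m.+1).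
  rewrite /e (bigID (fun w : m.+1.-tuple 'I_p => isSome (ncstack w))) /= natrD mulrDl -/N1 -/N2.
  by rewrite addrAC.
apply: le_trans (ler_normD _ _) _.
rewrite [X in _ + X]ger0_norm; last by rewrite divr_ge0 ?mulr_ge0 ?exprn_ge0.
apply: le_trans (lerD err1 err2) _.
rewrite -mulrDl ler_pM2r ?invr_gt0 //.
(* As l >= 2, l^(l+1) is at least 4 l^(l-1). This absorbs the crossing part, at most (4 + 3s)
   l^(l-1), into (1 + s) l^(l+1). *)
have L4 : 4 * (m.+1 ^ m)%:R <= (m.+1 ^ m.+2)%:R :> R.
  rewrite -natrM ler_nat !expnS mulnA leq_mul2r; apply/orP; right.
  by nia.
have L0 : 0 <= (m.+1 ^ m)%:R :> R by [].
rewrite natrM -natr1; nra.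
Qed.
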